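(* Every rectifiable simple closed curve $\mathcal{C}\subset\mathbb{S}^2$ of length $L\ge2\pi$ satisfies $\mathcal{J}(\mathcal{C})\ge j(L)$, where $$j(L)=\vartheta-\tan\frac{\vartheta}{2},\qquad \vartheta\in(0,\pi/2],\quad \sin\vartheta=\frac{2\pi}{L}.$$
   Context: $\mathbb{S}^2$ is the unit sphere in $\mathbb{R}^3$ with area element $dA$; $\operatorname{dist}(x,\mathcal{C})=\min_{y\in\mathcal{C}}\arccos\langle x,y\rangle$; $\mathcal{J}(\mathcal{C})=\frac{1}{4\pi}\int_{\mathbb{S}^2}\operatorname{dist}(x,\mathcal{C})\,dA(x)$. *)

(* Defs.v *)
From mathcomp Require Export all_boot all_order all_algebra.
From mathcomp Require Export all_classical all_reals all_analysis.
Export Order.TTheory GRing.Theory Num.Theory.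
Export numFieldNormedType.Exports.

Set Implicit Arguments.
Unset Strict Implicit.
Unset Printing Implicit Defensive.

Local Open Scope classical_set_scope.
Local Open Scope ring_scope.

Definition dot (R : realType) (x y : 'rV[R]_3) : R :=
  \sum_(i < 3) x 0 i * y 0 i.

(* The library norm `|x| on row vectors is the sup norm; lengths need this
   one.  Both define the same topology. *)
Definition enorm (R : realType) (x : 'rV[R]_3) : R := Num.sqrt (dot x x).

Definition sphere (R : realType) : set 'rV[R]_3 := [set x | enorm x = 1].
Arguments sphere : clear implicits.

(* The parameter interval is [0, 1]; gamma is unconstrained outside it. *)
Definition simple_closed_param (R : realType) (C : set 'rV[R]_3)
    (gamma : R -> 'rV[R]_3) : Prop :=
  [/\ {within `[0, 1], continuous gamma},
      gamma @` `[0, 1] = C,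
      gamma 0 = gamma 1 &
      forall s t : R, 0 <= s < 1 -> 0 <= t < 1 -> gamma s = gamma t -> s = t].

(* Length of the polygon inscribed in gamma with vertices at a and at the
   points of s; itv_partition a b s says that a :: s increases strictly and
   ends at b. *)
Definition polygon_length (R : realType) (a b : R) (gamma : R -> 'rV[R]_3)
    (s : seq R) : R :=
  \sum_(0 <= i < size s)
    enorm (gamma (nth b (a :: s) i.+1) - gamma (nth b (a :: s) i)).

Definition curve_length (R : realType) (a b : R) (gamma : R -> 'rV[R]_3) :
    \bar R :=
  ereal_sup [set (polygon_length a b gamma s)%:E | s in itv_partition a b].

(* L is a real number, so this includes rectifiability.  All simple closed
   parametrizations of C have the same length. *)
Definition simple_closed_curve_of_length (R : realType)
    (C : set 'rV[R]_3) (L : R) : Prop :=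
  exists2 gamma : R -> 'rV[R]_3,
    simple_closed_param C gamma & curve_length 0 1 gamma = L%:E.

(* The infimum is a minimum when C is compact and nonempty. *)
Definition sdist (R : realType) (x : 'rV[R]_3) (C : set 'rV[R]_3) : R :=
  inf [set acos (dot x y) | y in C].

Definition row3 (R : realType) (a b c : R) : 'rV[R]_3 :=
  \row_(i < 3) [:: a; b; c]`_i.

(* z.1 is the longitude and z.2 the colatitude. *)
Definition spherical_coord (R : realType) (z : R * R) : 'rV[R]_3 :=
  row3 (sin z.2 * cos z.1) (sin z.2 * sin z.1) (cos z.2).

(* Integral over the unit sphere for dA = sin(colatitude) d(longitude)
   d(colatitude). *)
Definition sphere_integral (R : realType) (f : 'rV[R]_3 -> R) : R :=
  Rintegral (@lebesgue_measure R \x @lebesgue_measure R)%E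
    (`[0, 2 * pi] `*` `[0, pi])
    (fun z => f (spherical_coord z) * sin z.2).

Definition mean_dist (R : realType) (C : set 'rV[R]_3) : R :=
  (4 * pi)^-1 * sphere_integral (fun x => sdist x C).

(* Main.v *)
From HB Require Import structures.
Require Import Defs.
From mathcomp Require Import measurable_realfun.
From mathcomp Require Import ring lra.

(** Fix a radius [tau <= pi/2] such that no open cap of radius [tau] contains the
    curve. Seen from a point [x] of the sphere, the angular distance to a point
    that runs once around the curve, cut off at [tau], reaches [tau] and also
    falls to [min (dist (x, C), tau)]. Since the curve is closed, its variation
    along the curve is at least [2 (tau - dist (x, C))]. Averaged over [x], the
    variation is easy to bound: moving a point from [p] to [q] changes its cut off
    distance to [x] by an amount whose integral over all [x] is at most
    [4 (1 - cos tau) angle (p, q)] ([two_point_capped_le]). Hence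

      [int (tau - dist (x, C))_+ dA <= 2 (1 - cos tau) L].

    For [tau = theta] this is the theorem, because [L = 2 pi / sin theta] and
    [theta - (1 - cos theta) / sin theta = theta - tan (theta / 2)].

    A curve of length at least [2 pi] may still lie in a small cap. Then [tau] is
    taken to be its circumradius ([exists_critical_radius]). For [tau <= t <= theta]
    the points within [t] of the curve lie in a cap of radius [t + tau <= 2 t],
    whose area is at most [4 pi sin^2 t <= 4 pi sin t <= 2 L sin t]. Integrated
    over [t], this is the contribution [2 L (cos tau - cos theta)] that is missing
    ([cap_deficit_le]). Both cases are treated at once in [pointwise_bound], where
    a difference of two functions of the distance to the centre of the cap
    vanishes for [tau = theta].

    The bound for a pair [p], [q] is computed after a rotation that brings both
    points to the equator ([two_point_normal_form]). On every circle of latitude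
    the cut off distance to [p] is then an even periodic function of the
    longitude, monotone on half a period, and the one to [q] is its translate; so
    the integral of the difference is at most the shift times the variation
    ([latitude_modulus]).

    The rotation invariance of the integral in spherical coordinates is clear for
    rotations about the polar axis. It remains to exchange the coordinates [x] and
    [z]. The substitution [z = cos t] (Archimedes) followed by [x = s cos p] on
    each circle of latitude writes the integral as one over the unit disc in [x]
    and [z] with the weight [1 / |y|], where the symmetry is evident
    ([sphere_lint_disc], [sphere_lint_swap]). The weight is singular at the
    boundary of the disc, so the substitution is proved for measurable functions,
    by comparing measures on intervals ([ge0_integral_image_density]).

    The length enters only through a finite partition of the curve of mesh [e], at
    the cost of a factor [1 / cos e] between angles and chords and of an error
    [O(e)] in the distances; finally [e] tends to [0]. *)

Set Implicit Arguments.
Unset Strict Implicit.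
Unset Printing Implicit Defensive.

Local Open Scope classical_set_scope.
Local Open Scope ring_scope.

(** * Densities and images of measures on the line *)

Section density.
Local Open Scope ereal_scope.
Context {R : realType}.
Notation mu := (@lebesgue_measure R).

(** [mrestr] over a [measurableType], the structure that integration expects of
    the carrier of a measure. *)
Definition restricted d (T : measurableType d) (m : {measure set T -> \bar R})
    (D : set T) (mD : measurable D) : set T -> \bar R := mrestr m mD.

HB.instance Definition _ d (T : measurableType d) (m : {measure set T -> \bar R})
    (D : set T) (mD : measurable D) := Measure.on (restricted m mD).

Lemma ge0_integral_restricted d (T : measurableType d) (m : {measure set T -> \bar R})
    (D : set T) (mD : measurable D) (f : T -> \bar R) :
  measurable_fun setT f -> (forall x, 0 <= f x) ->
  \int[restricted m mD]_x f x = \int[m]_(x in D) f x.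
Proof.
move=> mf f0; rewrite -(setUv D) ge0_integral_setU//; last 3 first.
- exact: measurableC.
- by rewrite setUv.
- exact/disj_setPCl.
rewrite [X in _ + X](_ : _ = 0) ?adde0; last first.
  have -> : \int[restricted m mD]_(x in ~` D) f x = \int[mzero]_(x in ~` D) f x.
    apply: eq_measure_integral => A mA AD /=.
    by rewrite /restricted /mrestr (_ : A `&` D = set0) ?measure0//;
      exact/disjoints_subset.
  exact: integral_measure_zero.
apply: eq_measure_integral => A mA AD /=.
by rewrite /restricted /mrestr setIidl.
Qed.

Lemma measurable_subgraph (D : set R) (w : R -> R) : measurable D ->
  measurable_fun setT w ->
  measurable [set z : R * R | D z.1 /\ (0 <= z.2 <= w z.1)%R].
Proof.
move=> mD mw.
have -> : [set z : R * R | D z.1 /\ (0 <= z.2 <= w z.1)%R] =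
   (fst @^-1` D) `&` ((snd @^-1` `[0%R, +oo[) `&`
   ((fun z : R * R => (w z.1 - z.2)%R) @^-1` `[0%R, +oo[)).
  apply/seteqP; split => z /=; rewrite !in_itv/= !andbT subr_ge0.
    by move=> [? /andP[]].
  by move=> [? [-> ->]].
apply: measurableI; first by rewrite -[X in measurable X]setTI; exact: measurable_fst.
apply: measurableI; first by rewrite -[X in measurable X]setTI; exact: measurable_snd.
rewrite -[X in measurable X]setTI; apply: measurable_funB => //.
exact: measurableT_comp.
Qed.

(** A density becomes a plain restriction of the product measure: the weight
    [w x] is the length of the vertical section of the subgraph of [w]. *)
Lemma integral_subgraph (D : set R) (w : R -> R) (H : R -> \bar R) :
  measurable D -> measurable_fun setT w -> (forall x, D x -> (0 <= w x)%R) ->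
  measurable_fun setT H -> (forall x, 0 <= H x) ->
  \int[mu \x mu]_(z in [set z : R * R | D z.1 /\ (0 <= z.2 <= w z.1)%R]) H z.1 =
  \int[mu]_(x in D) (H x * (w x)%:E).
Proof.
move=> mD mw w0 mH H0; set S := [set z | _].
have mS : measurable S := measurable_subgraph mD mw.
rewrite integral_mkcond fubini_tonelli1//; last 2 first.
- apply/(measurable_restrictT _ _).1 => //; apply: measurable_funTS.
  exact: measurableT_comp.
- by move=> z; exact: erestrict_ge0.
rewrite [RHS]integral_mkcond; apply: eq_integral => x _.
rewrite /fubini_F /= [in RHS]patchE; case: ifPn => [/set_mem Dx|/negP xD]; last first.
  by apply: integral0_eq => y _; rewrite patchE ifF//; apply/negP => /set_mem[] /mem_set.
transitivity (\int[mu]_(y in `[0%R, w x]) cst (H x) y).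
  rewrite [RHS]integral_mkcond; apply: eq_integral => y _.
  rewrite !patchE; congr (if _ then _ else _).
  by apply/idP/idP => /set_mem/= => [[_ h]|h]; apply/mem_set => //=; rewrite ?in_itv.
rewrite integral_cst//= lebesgue_measure_itv /= lte_fin.
case: ltP => h; first by rewrite oppr0 adde0.
by rewrite (_ : w x = 0%R) //; apply/eqP; rewrite eq_le h w0.
Qed.

(** Change of variables for all nonnegative measurable functions. Two measures
    on the line that agree on the intervals [`]a, b]] are equal, so the
    hypothesis on intervals carries over to Borel sets and to integrals. Since
    [G] is only measurable, it may be singular at the ends of [B]. *)
Lemma ge0_integral_image_density (D B : set R) (w F : R -> R) :
  measurable D -> measurable B ->
  measurable_fun setT w -> (forall x, D x -> (0 <= w x)%R) ->
  measurable_fun setT F -> (forall x, D x -> B (F x)) ->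
  (forall a b, (a <= b)%R -> \int[mu]_(x in D `&` F @^-1` `]a, b]) (w x)%:E =
    mu (B `&` `]a, b])) ->
  forall G : R -> \bar R, measurable_fun setT G -> (forall x, 0 <= G x) ->
  \int[mu]_(x in D) (G (F x) * (w x)%:E) = \int[mu]_(x in B) G x.
Proof.
move=> mD mB mw w0 mF FB FDB G mG G0.
set S := [set z : R * R | D z.1 /\ (0 <= z.2 <= w z.1)%R].
have mS : measurable S := measurable_subgraph mD mw.
(* The image of the density, completed by the Lebesgue measure outside [B]. *)
pose FF : R * R -> measurableTypeR R := F \o fst.
have mFF : measurable_fun setT FF by exact: measurableT_comp.
pose m1 : {measure set (measurableTypeR R) -> \bar R} :=
  measure_function_pushforward__canonical__measure_function_Measure
    (restricted (mu \x mu) mS) mFF.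
have m1E A : measurable A ->
    m1 A = \int[mu]_(x in D `&` F @^-1` A) (w x)%:E.
  move=> mA; rewrite /m1 /= /pushforward /restricted /mrestr.
  rewrite -[LHS]integral_indic //; last first.
    by rewrite -[X in measurable X]setTI; exact: (mFF).
  rewrite (@integral_subgraph D w (fun x => (\1_A (F x))%:E))//; last first.
    by apply: measurableT_comp => //; apply: measurableT_comp => //;
      exact: measurable_indic.
  rewrite integral_mkcondr; apply: eq_integral => x _.
  rewrite patchE indicE.
  rewrite (_ : (x \in F @^-1` A) = (F x \in A));
    last by apply/idP/idP => /set_mem/mem_set.
  by case: ifPn => _; rewrite ?mul1e ?mul0e.
pose nu : {measure set (measurableTypeR R) -> \bar R} :=
  measure_add m1 (restricted mu (measurableC mB)).
have nu_def A : nu A = m1 A + mu (A `&` ~` B) by exact: measure_addE.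
have nuE A : measurable A -> mu A = nu A.
  apply: (@lebesgue_measure_unique R nu) => _ [[a b] /= ab <-].
  rewrite nu_def m1E//; have [{}ab|ba] := leP a b; last first.
    rewrite set_itv_ge ?bnd_simp -?leNgt ?ltW//.
    by rewrite preimage_set0 setI0 integral_set0 set0I measure0 adde0.
  rewrite FDB// setIC -measureU//.
  - by rewrite -setIUr setUv setIT.
  - by apply: measurableI => //.
  - by apply: measurableI => //; exact: measurableC.
  - by rewrite setIACA setICr setI0.
have mGF : measurable_fun setT (G \o F) by exact: measurableT_comp.
transitivity (\int[m1]_x G x).
  transitivity (\int[mu \x mu]_(z in S) (G \o F) z.1).
    by apply/esym; apply: (@integral_subgraph D w (G \o F)) => // x; exact: G0.
  transitivity (\int[restricted (mu \x mu) mS]_z (G \o F) z.1).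
    apply: esym; apply: (ge0_integral_restricted (mu \x mu) mS) => [|z]; last exact: G0.
    exact: (measurableT_comp mGF measurable_fst).
  by rewrite /m1 ge0_integral_pushforward//= preimage_setT.
have m1C : m1 (~` B) = 0.
  rewrite m1E; last exact: measurableC.
  rewrite (_ : _ `&` _ = set0) ?integral_set0//.
  by apply/seteqP; split => // x [/FB].
rewrite -(setUv B) ge0_integral_setU//; last 3 first.
- exact: measurableC.
- by rewrite setUv.
- exact/disj_setPCl.
rewrite [X in _ + X](_ : _ = 0) ?adde0; last first.
  apply: null_set_integral => //; first exact: measurableC.
  exact: measurable_funTS.
apply: eq_measure_integral => A mA AB.
rewrite [RHS](nuE _ mA) nu_def.
rewrite (_ : A `&` _ = set0) ?measure0 ?adde0//.
by apply/disjoints_subset; rewrite setCK.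
Qed.
End density.

(** * The substitution [x = s cos t] *)

Section cos_substitution.
Local Open Scope ereal_scope.
Context {R : realType}.
Notation mu := (@lebesgue_measure R).

Lemma integral_antiderivative (f F : R -> R) (a b : R) : (a <= b)%R ->
  continuous f -> (forall x : R, is_derive x (1%R : R) F (f x)) ->
  \int[mu]_(x in `[a, b]) (f x)%:E = (F b - F a)%:E.
Proof.
rewrite le_eqVlt => /predU1P[<- _ _|ab cf dF].
  by rewrite set_itv1 integral_set1 subrr.
have cF : continuous F.
  by move=> x; apply: differentiable_continuous; apply/derivable1_diffP; apply: ex_derive.
rewrite (@continuous_FTC2 _ f F)//.
- exact: continuous_subspaceT.
- split.
  + by move=> x _; apply: ex_derive.
  + by apply: cvg_at_right_filter; exact: cF.
  + by apply: cvg_at_left_filter; exact: cF.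
- by move=> x _; rewrite derive1E; apply: derive_val.
Qed.

Lemma lt_acos (c x : R) : (-1 <= c <= 1)%R -> (0 <= x <= pi)%R ->
  (x < acos c)%R = (c < cos x)%R.
Proof.
move=> c1 xpi; rewrite -{2}(acosK (x:=c)) ?in_itv//.
by rewrite ltr_cos// in_itv/= acos_ge0// acos_lepi.
Qed.

Lemma acos_le (c x : R) : (-1 <= c <= 1)%R -> (0 <= x <= pi)%R ->
  (acos c <= x)%R = (cos x <= c)%R.
Proof. by move=> c1 xpi; rewrite leNgt lt_acos// -leNgt. Qed.

Lemma preimage_cos_itv (s a b : R) : (0 < s)%R -> (- s <= a)%R -> (a <= b)%R ->
  (b <= s)%R ->
  `[0%R, pi[ `&` (fun x => s * cos x)%R @^-1` `]a, b] =
  `[acos (b / s), acos (a / s)[%classic.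
Proof.
move=> s0 sa ab bs.
have bnd c : (- s <= c <= s)%R -> (-1 <= c / s <= 1)%R.
  by rewrite ler_pdivlMr// ler_pdivrMr// mul1r mulN1r.
have hb : (-1 <= b / s <= 1)%R by apply: bnd; rewrite bs andbT (le_trans sa).
have ha : (-1 <= a / s <= 1)%R by apply: bnd; rewrite sa (le_trans ab).
have key x : (0 <= x <= pi)%R ->
    (a < s * cos x <= b)%R = (acos (b / s) <= x < acos (a / s))%R.
  move=> xpi; rewrite lt_acos// acos_le// ltr_pdivrMr// ler_pdivlMr//.
  by rewrite mulrC andbC.
apply/seteqP; split => x /=; rewrite !in_itv/=.
  by move=> [/andP[x0 xpi]]; rewrite key// x0 ltW.
move=> /andP[bx xa].
have x0 : (0 <= x)%R by apply: le_trans bx; exact: acos_ge0.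
have xpi : (x < pi)%R by apply: (lt_le_trans xa); exact: acos_lepi.
have xI : (0 <= x <= pi)%R by rewrite x0 ltW.
by rewrite (key _ xI) bx xa x0 xpi.
Qed.

(** The substitution [x = s cos t]. With half-open intervals the preimage of
    [`]a, b]] is exactly an interval between two values of [acos]. *)
Lemma ge0_integral_cos_substitution (s : R) (G : R -> \bar R) : (0 < s)%R ->
  measurable_fun setT G -> (forall x, 0 <= G x) ->
  \int[mu]_(x in `[0%R, pi[) (G (s * cos x)%R * (s * sin x)%R%:E) =
  \int[mu]_(x in `](- s)%R, s]) G x.
Proof.
move=> s0 mG G0.
have ms : measurable_fun setT (fun x : R => s * sin x)%R.
  apply: measurable_funM => //; apply: continuous_measurable_fun; exact: continuous_sin.
have mc : measurable_fun setT (fun x : R => s * cos x)%R.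
  apply: measurable_funM => //; apply: continuous_measurable_fun; exact: continuous_cos.
apply: (@ge0_integral_image_density _ `[0%R, pi[ `](- s)%R, s] (fun x =>
  s * sin x)%R (fun x => s * cos x)%R) => //.
- move=> x /=; rewrite in_itv/= => /andP[x0 xpi].
  by apply: mulr_ge0; [exact: ltW|apply: sin_ge0_pi; rewrite x0 ltW].
- move=> x /=; rewrite !in_itv/= => /andP[x0 xpi].
  rewrite -[X in (_ <= X)%R]mulr1 ler_pM2l// cos_le1 andbT.
  rewrite -mulrN1 ltr_pM2l// -cospi ltr_cos ?in_itv//= ?x0 ?(ltW xpi) ?pi_ge0 ?lexx//=.
move=> a b ab.
pose a' := Num.max a (-s)%R; pose b' := Num.min b s.
have -> : `](- s)%R, s] `&` `]a, b] = `]a', b']%classic.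
  apply/seteqP; split => x /=; rewrite !in_itv/= gt_max le_min.
    by move=> [/andP[-> ->] /andP[-> ->]].
  by move=> /andP[/andP[-> ->] /andP[-> ->]].
have -> : `[0%R, pi[ `&` (fun x => s * cos x)%R @^-1` `]a, b] =
          `[0%R, pi[ `&` (fun x => s * cos x)%R @^-1` `]a', b'].
  apply/seteqP; split => x /=; rewrite !in_itv/= gt_max le_min.
    move=> [/andP[x0 xpi] /andP[-> ->]]; rewrite x0 xpi; split => //=.
    rewrite -[X in (_ && (_ <= X))%R]mulr1 ler_pM2l// cos_le1 andbT.
    rewrite -mulrN1 ltr_pM2l// -cospi ltr_cos ?in_itv//= ?x0 ?(ltW xpi) ?pi_ge0 ?lexx//=.
  by move=> [-> /andP[/andP[-> _] /andP[-> _]]].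
have [ab'|ba'] := leP a' b'; last first.
  rewrite (_ : `]a', b']%classic = set0);
    last by rewrite set_itv_ge// bnd_simp -leNgt ltW.
  by rewrite preimage_set0 setI0 integral_set0 measure0.
have sa' : (- s <= a')%R by rewrite le_max lexx orbT.
have sb' : (b' <= s)%R by rewrite ge_min lexx orbT.
rewrite preimage_cos_itv// integral_itv_bndo_bndc; last first.
  exact/measurable_funTS/measurable_EFinP.
have bnd c : (- s <= c <= s)%R -> (-1 <= c / s <= 1)%R.
  by rewrite ler_pdivlMr// ler_pdivrMr// mul1r mulN1r.
have hb : (-1 <= b' / s <= 1)%R by apply: bnd; rewrite sb' andbT (le_trans sa').
have ha : (-1 <= a' / s <= 1)%R by apply: bnd; rewrite sa' (le_trans ab').
have dF (x : R) : is_derive x (1%R : R) (fun x => - (s * cos x))%R (s * sin x)%R.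
  by apply: is_derive_eq; rewrite /= /GRing.scale/=; ring.
rewrite (integral_antiderivative _ _ dF).
- rewrite !acosK ?in_itv//= lebesgue_measure_itv/= lte_fin.
  have -> : (- (s * (a' / s)) - - (s * (b' / s)) = b' - a')%R.
    by rewrite ![(s * _)%R]mulrC !divfK ?gt_eqF// addrC opprK.
  case: ltP => // h; congr EFin; apply/eqP; by rewrite subr_eq0 eq_le h ab'.
- rewrite leNgt -ltr_cos ?in_itv/= ?acos_ge0 ?acos_lepi//.
  by rewrite !acosK ?in_itv//= -leNgt ler_pM2r// invr_gt0.
- by move=> x; apply: cvgM; [exact: cvg_cst|exact: continuous_sin].
Qed.

End cos_substitution.

(** * Translations and reflections *)

Section translation.
Local Open Scope ereal_scope.
Context {R : realType}.
Notation mu := (@lebesgue_measure R).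
Implicit Types (G : R -> \bar R) (c : R).

Lemma ge0_integral_shiftT c G : measurable_fun setT G -> (forall x, 0 <= G x) ->
  \int[mu]_x G (x + c)%R = \int[mu]_x G x.
Proof.
move=> mG G0; rewrite -[RHS](@ge0_integral_image_density _ setT setT (cst 1%R) (fun x =>
  x + c)%R)//.
- by apply: eq_integral => x _; rewrite mule1.
- exact: measurable_funD.
move=> a b ab; rewrite setTI (_ : _ @^-1` _ = `](a - c)%R, (b - c)%R]%classic);
  last first.
  by apply/seteqP; split => x /=; rewrite !in_itv/= ltrBlDr lerBrDr.
rewrite (eq_integral (cst 1%:E))// integral_cst// mul1e setTI.
apply: etrans (lebesgue_measure_itv _) _; rewrite lebesgue_measure_itv/= !lte_fin ltrD2r.
by case: ifP => // _; rewrite -!EFinD; congr EFin; ring.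
Qed.

Lemma ge0_integral_reflectT c G : measurable_fun setT G -> (forall x, 0 <= G x) ->
  \int[mu]_x G (c - x)%R = \int[mu]_x G x.
Proof.
move=> mG G0; rewrite -[RHS](@ge0_integral_image_density _ setT setT (cst 1%R) (fun x =>
  c - x)%R)//.
- by apply: eq_integral => x _; rewrite mule1.
- exact: measurable_funB.
move=> a b ab; rewrite setTI (_ : _ @^-1` _ = `[(c - b)%R, (c - a)%R[%classic);
  last first.
  apply/seteqP; split => x /=; rewrite !in_itv/= => /andP[h1 h2]; apply/andP; split; lra.
rewrite (eq_integral (cst 1%:E))// integral_cst// mul1e setTI.
apply: etrans (lebesgue_measure_itv _) _;
  rewrite lebesgue_measure_itv/= !lte_fin ltrD2l ltrN2.
by case: ifP => // _; rewrite -!EFinD; congr EFin; ring.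
Qed.

Lemma ge0_integral_shift (i j : interval R) c G : measurable_fun setT G ->
  (forall x, 0 <= G x) ->
  (forall x, (x \in i) = (x + c \in j)%R) ->
  \int[mu]_(x in [set` i]) G (x + c)%R = \int[mu]_(x in [set` j]) G x.
Proof.
move=> mG G0 ij; rewrite [RHS]integral_mkcond -(@ge0_integral_shiftT c).
- rewrite [LHS]integral_mkcond; apply: eq_integral => x _.
  by rewrite !patchE !mem_setE ij.
- by apply/(measurable_restrictT _ _).1 => //; exact: measurable_funTS.
- by move=> x; exact: erestrict_ge0.
Qed.

Lemma ge0_integral_reflect (i j : interval R) c G : measurable_fun setT G ->
  (forall x, 0 <= G x) ->
  (forall x, (x \in i) = (c - x \in j)%R) ->
  \int[mu]_(x in [set` i]) G (c - x)%R = \int[mu]_(x in [set` j]) G x.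
Proof.
move=> mG G0 ij; rewrite [RHS]integral_mkcond -(@ge0_integral_reflectT c).
- rewrite [LHS]integral_mkcond; apply: eq_integral => x _.
  by rewrite !patchE !mem_setE ij.
- by apply/(measurable_restrictT _ _).1 => //; exact: measurable_funTS.
- by move=> x; exact: erestrict_ge0.
Qed.

Lemma ge0_integral_itvU (a b c : R) (G : R -> \bar R) : (a <= b)%R -> (b <= c)%R ->
  measurable_fun setT G -> (forall x, 0 <= G x) ->
  \int[mu]_(x in `[a, c]) G x = \int[mu]_(x in `[a, b]) G x + \int[mu]_(x in `[b, c]) G x.
Proof.
move=> ab bc mG G0.
rewrite -[X in _ = X + _]integral_itv_bndo_bndc; last exact: measurable_funTS.
rewrite -ge0_integral_setU//.
- congr integral; apply/seteqP; split => x /=; rewrite !in_itv/=.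
    by move=> /andP[ax xc]; case: (ltP x b) => xb; [left; rewrite ax|right].
  by case=> /andP[h1 h2]; apply/andP; split => //; [lra|lra].
- exact: measurable_funTS.
- apply/disj_setPS => x /= []; rewrite !in_itv/= => /andP[_ xb] /andP[bx _].
  by move: xb; rewrite ltNge bx.
Qed.

(** The window [[c, T + c]] differs from [[0, T]] by the piece [[0, c]], moved by
    one period. *)
Lemma ge0_integral_periodic (T c : R) (G : R -> \bar R) : (0 <= c <= T)%R ->
  measurable_fun setT G -> (forall x, 0 <= G x) -> (forall x, G (x + T)%R = G x) ->
  \int[mu]_(x in `[0%R, T]) G (x + c)%R = \int[mu]_(x in `[0%R, T]) G x.
Proof.
move=> /andP[c0 cT] mG G0 GT.
rewrite (@ge0_integral_shift `[0%R, T] `[c, (T + c)%R])//; last first.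
  by move=> x; rewrite !in_itv/= lerD2r -lerBlDr subrr.
rewrite (@ge0_integral_itvU c T)//; last by rewrite -lerBlDl subrr.
rewrite [RHS](@ge0_integral_itvU 0%R c)// addeC; congr (_ + _).
rewrite -(@ge0_integral_shift `[0%R, c] _ T)//.
  by apply: eq_integral => x _; rewrite GT.
move=> x; rewrite !in_itv/= [(T + c)%R]addrC lerD2r; congr (_ && _).
by rewrite -lerBlDr subrr.
Qed.

End translation.

(** * The integral over the sphere *)

Section sphere_functional.
Local Open Scope ereal_scope.
Context {R : realType}.
Notation mu := (@lebesgue_measure R).

Lemma ge0_integral_setX1 (A B : set R) (h : R -> R -> \bar R) :
  measurable A -> measurable B ->
  measurable_fun setT (fun z : R * R => h z.1 z.2) ->
  (forall x y, A x -> B y -> 0 <= h x y) ->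
  \int[mu \x mu]_(z in A `*` B) h z.1 z.2 = \int[mu]_(x in A) \int[mu]_(y in B) h x y.
Proof.
move=> mA mB mh h0; rewrite integral_mkcond fubini_tonelli1.
- rewrite [RHS]integral_mkcond; apply: eq_integral => x _.
  rewrite /fubini_F /= patchE; case: ifPn => [/set_mem Ax|/negP Ax].
    rewrite [RHS]integral_mkcond; apply: eq_integral => y _; rewrite !patchE.
    congr (if _ then _ else _).
    by apply/idP/idP => /set_mem => [[_ /mem_set]|By]//; apply/mem_set; split.
  apply: integral0_eq => y _; rewrite patchE ifF//; apply/negP => /set_mem[] /= /mem_set.
  by [].
- apply/(measurable_restrictT _ _).1; first exact: measurableX.
  exact: measurable_funTS.
- by move=> z; apply: erestrict_ge0 => -[x y] [/= Ax By]; exact: h0.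
Qed.

Lemma ge0_integral_setX2 (A B : set R) (h : R -> R -> \bar R) :
  measurable A -> measurable B ->
  measurable_fun setT (fun z : R * R => h z.1 z.2) ->
  (forall x y, A x -> B y -> 0 <= h x y) ->
  \int[mu \x mu]_(z in A `*` B) h z.1 z.2 = \int[mu]_(y in B) \int[mu]_(x in A) h x y.
Proof.
move=> mA mB mh h0; rewrite integral_mkcond fubini_tonelli2.
- rewrite [RHS]integral_mkcond; apply: eq_integral => y _.
  rewrite /fubini_G /= patchE; case: ifPn => [/set_mem By|/negP By].
    rewrite [RHS]integral_mkcond; apply: eq_integral => x _; rewrite !patchE.
    congr (if _ then _ else _).
    by apply/idP/idP => /set_mem => [[/mem_set]|Ax]//; apply/mem_set; split.
  apply: integral0_eq => x _; rewrite patchE ifF//;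
    apply/negP => /set_mem[] /= _ /mem_set.
  by [].
- apply/(measurable_restrictT _ _).1; first exact: measurableX.
  exact: measurable_funTS.
- by move=> z; apply: erestrict_ge0 => -[x y] [/= Ax By]; exact: h0.
Qed.

Definition measurable3 (f : R -> R -> R -> R) :=
  measurable_fun [set: R * R * R] (fun w => f w.1.1 w.1.2 w.2).

Lemma measurable3_comp (f : R -> R -> R -> R) d (T : measurableType d) (X Y Z : T -> R) :
  measurable3 f -> measurable_fun setT X -> measurable_fun setT Y ->
  measurable_fun setT Z -> measurable_fun setT (fun t => f (X t) (Y t) (Z t)).
Proof.
move=> mf mX mY mZ; apply: (measurableT_comp mf (measurable_fun_pair (measurable_fun_pair
  mX mY) mZ)).
Qed.

Lemma measurable_section1 (h : R -> R -> \bar R) (y : R) :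
  measurable_fun setT (fun z : R * R => h z.1 z.2) -> measurable_fun setT (h ^~ y).
Proof.
move=> mh; pose g := fun x : R => (x, y).
have mg : measurable_fun setT g by exact: measurable_fun_pair.
exact: (measurableT_comp mh mg).
Qed.

Lemma measurable_section2 (h : R -> R -> \bar R) (x : R) :
  measurable_fun setT (fun z : R * R => h z.1 z.2) -> measurable_fun setT (h x).
Proof.
move=> mh; pose g := fun y : R => (x, y).
have mg : measurable_fun setT g by exact: measurable_fun_pair.
exact: (measurableT_comp mh mg).
Qed.

Lemma measurable_sin : measurable_fun [set: R] (@sin R).
Proof. by apply: continuous_measurable_fun; exact: continuous_sin. Qed.

Lemma measurable_cos : measurable_fun [set: R] (@cos R).
Proof. by apply: continuous_measurable_fun; exact: continuous_cos. Qed.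

Lemma measurable_sqrt : measurable_fun [set: R] (@Num.sqrt R).
Proof. by apply: continuous_measurable_fun; exact: sqrt_continuous. Qed.

Lemma measurable_sqrtV : measurable_fun [set: R] (fun u : R => (Num.sqrt u)^-1%R).
Proof.
rewrite (_ : (fun _ => _) = (fun u : R => powR (Num.sqrt u) (-1)%R)); last first.
  by apply/funext => u; rewrite powR_inv1// sqrtr_ge0.
by apply: (measurableT_comp (measurable_powR _)); exact: measurable_sqrt.
Qed.

(** The sphere integral with values in [\bar R], so that nonnegative functions
    can be handled without integrability conditions. The function takes the three
    coordinates, so that measurability refers to the product of three lines. *)
Definition sphere_lint (f : R -> R -> R -> R) : \bar R :=
  \int[mu]_(t in `[0%R, pi]) \int[mu]_(p in `[0%R, (2 * pi)%R])
    (f (sin t * cos p) (sin t * sin p) (cos t) * sin t)%R%:E.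

(** The unit disc, in the coordinates [x] and [z], parametrizes both hemispheres
    [0 < y] and [y < 0], and there [dA = dx dz / |y|]. Outside of the disc the
    square root and its inverse are both [0]. *)
Definition disc_density (f : R -> R -> R -> R) (x z : R) : R :=
  let r := Num.sqrt (1 - x ^+ 2 - z ^+ 2) in
  ((f x r z + f x (- r) z) / r)%R.

Lemma measurable_disc_density f : measurable3 f ->
  measurable_fun setT (fun w : R * R => (disc_density f w.1 w.2)%:E).
Proof.
move=> mf; apply/measurable_EFinP; rewrite /disc_density/=.
have mr : measurable_fun setT (fun w : R * R => 1 - w.1 ^+ 2 - w.2 ^+ 2)%R.
  by apply: measurable_funB; [apply: measurable_funB => //|]; exact: measurable_funX.
have ms : measurable_fun setT (fun w : R * R => Num.sqrt (1 - w.1 ^+ 2 - w.2 ^+ 2))%R.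
  exact: (measurableT_comp measurable_sqrt).
apply: measurable_funM; last exact: (measurableT_comp measurable_sqrtV).
apply: measurable_funD; apply: measurable3_comp => //.
exact: measurableT_comp.
Qed.

Lemma disc_density_ge0 f x z : (forall x y z, 0 <= f x y z)%R ->
  (0 <= disc_density f x z)%R.
Proof. by move=> f0; rewrite /disc_density mulr_ge0 ?invr_ge0 ?sqrtr_ge0// addr_ge0. Qed.

Lemma disc_density_out f x z : (1 - x ^+ 2 - z ^+ 2 <= 0)%R -> disc_density f x z = 0%R.
Proof. by move=> h; rewrite /disc_density ler0_sqrtr// invr0 mulr0. Qed.

Lemma measurable_sphere_integrand f : measurable3 f ->
  measurable_fun setT (fun w : R * R =>
    (f (sin w.1 * cos w.2) (sin w.1 * sin w.2) (cos w.1) * sin w.1)%R%:E).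
Proof.
move=> mf; apply/measurable_EFinP.
have m1 : measurable_fun setT (fun w : R * R => sin w.1).
  exact: (measurableT_comp measurable_sin).
apply: measurable_funM => //; apply: measurable3_comp => //.
- by apply: measurable_funM => //; exact: (measurableT_comp measurable_cos).
- by apply: measurable_funM => //; exact: (measurableT_comp measurable_sin).
- exact: (measurableT_comp measurable_cos).
Qed.

Lemma measurable_cylinder f : measurable3 f ->
  measurable_fun setT (fun w : R * R =>
    (f (Num.sqrt (1 - w.1 ^+ 2) * cos w.2) (Num.sqrt (1 - w.1 ^+ 2) * sin w.2) w.1)%R%:E).
Proof.
move=> mf; apply/measurable_EFinP.
have m1 : measurable_fun setT (fun w : R * R => Num.sqrt (1 - w.1 ^+ 2))%R.
  by apply: (measurableT_comp measurable_sqrt); apply: measurable_funB => //;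
    exact: measurable_funX.
apply: measurable3_comp => //.
- by apply: measurable_funM => //; exact: (measurableT_comp measurable_cos).
- by apply: measurable_funM => //; exact: (measurableT_comp measurable_sin).
Qed.

(** Archimedes: the projection from the sphere to the circumscribed cylinder
    preserves the area, because [dz = - sin t dt] for [z = cos t]. *)
Lemma sphere_lint_cylinder f : measurable3 f -> (forall x y z, 0 <= f x y z)%R ->
  sphere_lint f = \int[mu]_(z in `](-1)%R, 1%R]) \int[mu]_(p in `[0%R, (2 * pi)%R])
    (f (Num.sqrt (1 - z ^+ 2) * cos p) (Num.sqrt (1 - z ^+ 2) * sin p) z)%R%:E.
Proof.
move=> mf f0; rewrite /sphere_lint.
have sin0 t : `[0%R, pi]%classic t -> (0 <= @sin R t)%R.
  by rewrite /= in_itv/=; exact: sin_ge0_pi.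
rewrite -(@ge0_integral_setX1 _ _ (fun t p =>
  (f (sin t * cos p) (sin t * sin p) (cos t) * sin t)%R%:E))//; last 2 first.
- exact: measurable_sphere_integrand.
- by move=> t p t0 _; rewrite lee_fin mulr_ge0// sin0.
rewrite (@ge0_integral_setX2 _ _ (fun t p =>
  (f (sin t * cos p) (sin t * sin p) (cos t) * sin t)%R%:E))//; last 2 first.
- exact: measurable_sphere_integrand.
- by move=> t p t0 _; rewrite lee_fin mulr_ge0// sin0.
rewrite -(@ge0_integral_setX1 _ _ (fun z p =>
  (f (Num.sqrt (1 - z ^+ 2) * cos p) (Num.sqrt (1 - z ^+ 2) * sin p) z)%R%:E))//;
  last 2 first.
- exact: measurable_cylinder.
- by move=> *; rewrite lee_fin.
rewrite (@ge0_integral_setX2 _ _ (fun z p =>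
  (f (Num.sqrt (1 - z ^+ 2) * cos p) (Num.sqrt (1 - z ^+ 2) * sin p) z)%R%:E))//;
  last 2 first.
- exact: measurable_cylinder.
- by move=> *; rewrite lee_fin.
apply: eq_integral => p _.
pose H z := (f (Num.sqrt (1 - z ^+ 2) * cos p) (Num.sqrt (1 - z ^+ 2) * sin p) z)%R%:E.
have mH : measurable_fun setT H.
  exact: (@measurable_section1 (fun z p => (f (Num.sqrt (1 - z ^+ 2) * cos p)
    (Num.sqrt (1 - z ^+ 2) * sin p) z)%R%:E) p (measurable_cylinder mf)).
rewrite -(@ge0_integral_cos_substitution R 1%R H ltr01 mH); last first.
  by move=> *; rewrite lee_fin.
rewrite -integral_itv_bndo_bndc; last first.
  apply: measurable_funTS.
  exact: (@measurable_section1 (fun t p =>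
    (f (sin t * cos p) (sin t * sin p) (cos t) * sin t)%R%:E)
    p (measurable_sphere_integrand mf)).
apply: eq_integral => t /set_mem; rewrite /= in_itv/= => /andP[t0 tpi].
by rewrite !mul1r -EFinM -sin2cos2 sqrtr_sqr ger0_norm// sin0//= in_itv/= t0 ltW.
Qed.
End sphere_functional.

(** * Invariance under rotations *)

Section rotation_invariance.
Local Open Scope ereal_scope.
Context {R : realType}.
Notation mu := (@lebesgue_measure R).
Implicit Types f : R -> R -> R -> R.

(** On the circle of latitude at height [z] the substitution [x = s cos p] turns
    the longitude element into [dx / |y|]; the two halves of the circle give the
    two signs of [y]. *)
Lemma latitude_integral_disc f (z : R) : measurable3 f ->
  (forall x y z, 0 <= f x y z)%R ->
  (-1 < z < 1)%R ->
  \int[mu]_(p in `[0%R, (2 * pi)%R])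
    (f (Num.sqrt (1 - z ^+ 2) * cos p) (Num.sqrt (1 - z ^+ 2) * sin p) z)%R%:E =
  \int[mu]_x (disc_density f x z)%:E.
Proof.
move=> mf f0 z1; set s : R := Num.sqrt (1 - z ^+ 2)%R.
have z2 : (0 < 1 - z ^+ 2)%R.
  by case/andP: z1 => ? ?; nra.
have s0 : (0 < s)%R by rewrite sqrtr_gt0.
have ss : (s ^+ 2 = 1 - z ^+ 2)%R by rewrite sqr_sqrtr// ltW.
pose h p := (f (s * cos p) (s * sin p) z)%:E.
have mh : measurable_fun setT h.
  exact: (@measurable_section2 R (fun z p => (f (Num.sqrt (1 - z ^+ 2) * cos p)
    (Num.sqrt (1 - z ^+ 2) * sin p) z)%R%:E) z (measurable_cylinder mf)).
have h0 p : 0 <= h p by rewrite lee_fin.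
have pi2 : (pi <= 2 * pi :> R)%R by have := @pi_ge0 R; lra.
rewrite -/(h _) (@ge0_integral_itvU _ 0%R pi)//; last exact: pi_ge0.
rewrite -[X in _ + X](@ge0_integral_reflect _ `[0%R, pi] _ (2 * pi)%R)//; last first.
  move=> x; rewrite !in_itv/=; apply/andP/andP => -[]; lra.
have mh2 : measurable_fun setT (fun x : R => h (2 * pi - x)%R).
  by apply: (measurableT_comp mh); exact: measurable_funB.
rewrite -ge0_integralD//;
  [|by move=> *; exact: h0|exact: measurable_funTS mh
   |by move=> *; exact: h0|exact: measurable_funTS mh2].
have mg : measurable_fun setT (fun x => (disc_density f x z)%:E).
  exact: (@measurable_section1 R (fun x z =>
    (disc_density f x z)%:E) z (measurable_disc_density mf)).
have g0 x : 0 <= (disc_density f x z)%:E by rewrite lee_fin disc_density_ge0.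
transitivity (\int[mu]_(x in `](- s)%R, s]) (disc_density f x z)%:E); last first.
  rewrite integral_mkcond; apply: eq_integral => x _.
  rewrite patchE; case: ifPn => // /negP xs; congr EFin; apply/esym/disc_density_out.
  rewrite addrAC -ss subr_le0; apply: contra_notT xs; rewrite -ltNge => xs.
  rewrite mem_setE in_itv/=; apply/andP; split; nra.
rewrite -ge0_integral_cos_substitution//.
(* The point [p = 0], where [sin p] does not cancel, is negligible. *)
rewrite -[RHS]integral_itv_obnd_cbnd; last first.
  apply: measurable_funTS; apply: emeasurable_funM; last apply/measurable_EFinP.
    by apply: (measurableT_comp mg); apply: measurable_funM => //; exact: measurable_cos.
  by apply: measurable_funM => //; exact: measurable_sin.
rewrite -[LHS]integral_itv_obnd_cbnd; last first.
  by apply: measurable_funTS; exact: emeasurable_funD.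
rewrite -[LHS]integral_itv_bndo_bndc; last first.
  by apply: measurable_funTS; exact: emeasurable_funD.
apply: eq_integral => p /set_mem /=; rewrite in_itv/= => /andP[p0 ppi].
have sp : (0 < sin p)%R by apply: sin_gt0_pi; rewrite p0.
rewrite /h /disc_density -EFinM -EFinD; congr EFin.
have -> : (1 - (s * cos p) ^+ 2 - z ^+ 2 = (s * sin p) ^+ 2)%R.
  by rewrite addrAC -ss !exprMn sin2cos2; ring.
rewrite sqrtr_sqr ger0_norm ?mulr_ge0 ?ltW// divfK ?mulf_neq0 ?gt_eqF//.
have e2 : (2 * pi = pi *+ 2 :> R)%R by rewrite mulr_natl.
by rewrite e2 cosB sinB cos2pi sin2pi !mul1r !mul0r addr0 sub0r mulrN.
Qed.

Lemma sphere_lint_disc f : measurable3 f -> (forall x y z, 0 <= f x y z)%R ->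
  sphere_lint f = \int[mu]_z \int[mu]_x (disc_density f x z)%:E.
Proof.
move=> mf f0; rewrite sphere_lint_cylinder//.
have mC : measurable_fun setT (fun z => \int[mu]_x (disc_density f x z)%:E).
  apply: (@measurable_fun_fubini_tonelli_G _ _ _ _ R mu (fun w =>
    (disc_density f w.1 w.2)%:E)).
    exact: measurable_disc_density.
  by move=> w; rewrite lee_fin disc_density_ge0.
(* At the poles [z = 1] and [z = -1] the circle is a point; both are negligible. *)
have circ : {in `](-1)%R, 1%R[%classic, (fun z => \int[mu]_x (disc_density f x z)%:E) =1
    fun z : R => \int[mu]_(p in `[0%R, (2 * pi)%R])
    (f (Num.sqrt (1 - z ^+ 2) * cos p) (Num.sqrt (1 - z ^+ 2) * sin p) z)%R%:E}.
  by move=> z /set_mem; rewrite /= in_itv/= => z1; rewrite latitude_integral_disc.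
rewrite -integral_itv_bndo_bndc; last first.
  by apply: (eq_measurable_fun _ circ); exact: measurable_funTS.
transitivity (\int[mu]_(z in `](-1)%R, 1%R[) \int[mu]_x (disc_density f x z)%:E).
  by apply: eq_integral => z /set_mem; rewrite /= in_itv/=; exact: latitude_integral_disc.
rewrite integral_mkcond; apply: eq_integral => z _.
rewrite patchE; case: ifPn => // /negP z1; apply/esym/integral0_eq => x _.
congr EFin; apply/disc_density_out.
rewrite leNgt; apply: contra_notN z1 => xs.
rewrite mem_setE in_itv/=; apply/andP; split; nra.
Qed.

Definition swap_xz f : R -> R -> R -> R := fun x y z => f z y x.

(** In the disc coordinates the two axes play the same role, so the exchange is
    Tonelli's theorem. *)
Lemma sphere_lint_swap f : measurable3 f -> (forall x y z, 0 <= f x y z)%R ->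
  sphere_lint (swap_xz f) = sphere_lint f.
Proof.
move=> mf f0; have ms : measurable3 (swap_xz f).
  rewrite /measurable3 /swap_xz; apply: (measurable3_comp mf) => //.
    exact: (measurableT_comp measurable_snd measurable_fst).
  exact: (measurableT_comp measurable_fst measurable_fst).
rewrite (sphere_lint_disc mf f0) (sphere_lint_disc ms (fun x y z => f0 z y x)).
have := @fubini_tonelli _ _ _ _ R mu mu (fun w =>
  (disc_density f w.1 w.2)%:E) (measurable_disc_density mf).
rewrite /fubini_F/= => <-; last by move=> w; rewrite lee_fin disc_density_ge0.
apply: eq_integral => z _; apply: eq_integral => x _; congr EFin.
by rewrite /disc_density /swap_xz addrAC.
Qed.

Definition rotate_xy (c : R) f : R -> R -> R -> R :=
  fun x y z => f (x * cos c - y * sin c)%R (x * sin c + y * cos c)%R z.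

(** A rotation about the polar axis shifts the longitude. *)
Lemma sphere_lint_rotate c f : (0 <= c <= 2 * pi)%R ->
  measurable3 f -> (forall x y z, 0 <= f x y z)%R ->
  sphere_lint (rotate_xy c f) = sphere_lint f.
Proof.
move=> c0 mf f0; apply: eq_integral => t /set_mem /=; rewrite in_itv/= => t0.
pose h p := (f (sin t * cos p) (sin t * sin p) (cos t) * sin t)%R%:E.
have st : (0 <= sin t)%R by exact: sin_ge0_pi.
rewrite -[RHS](@ge0_integral_periodic _ _ c h)//.
- by apply: eq_integral => p _; rewrite /h cosD sinD /rotate_xy;
  congr (f _ _ _ * _)%R%:E; ring.
- exact: (@measurable_section2 R (fun t p =>
  (f (sin t * cos p) (sin t * sin p) (cos t) * sin t)%R%:E)
  t (measurable_sphere_integrand mf)).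
- by move=> p; rewrite lee_fin mulr_ge0.
- by move=> p; rewrite /h mulr_natl sinD2pi cosD2pi.
Qed.
End rotation_invariance.

(** * Integrals over circles of latitude and over ramps *)

Section modulus.
Local Open Scope ereal_scope.
Context {R : realType}.
Notation mu := (@lebesgue_measure R).

Lemma ge0_integral_EFin_fin (h : R -> R) (a b M : R) : measurable_fun setT h ->
  (forall x, 0 <= h x <= M)%R ->
  exists r : R, \int[mu]_(x in `[a, b]) (h x)%:E = r%:E.
Proof.
move=> mh hM; exists (fine (\int[mu]_(x in `[a, b]) (h x)%:E));
  rewrite fineK// ge0_fin_numE; last first.
  by apply: integral_ge0 => x _; rewrite lee_fin; case/andP: (hM x).
apply: (@le_lt_trans _ _ (\int[mu]_(x in `[a, b]) cst M%:E x)).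
  apply: ge0_le_integral => //.
  - by move=> x _; rewrite lee_fin; case/andP: (hM x).
  - by apply: measurable_funTS; exact/measurable_EFinP.
  - by move=> x _; rewrite lee_fin; case/andP: (hM x).
rewrite integral_cst//= lebesgue_measure_itv/=.
by case: ifP => _; rewrite ?mule0 ?ltry// -EFinD -EFinM ltry.
Qed.

Lemma integral_le_cst (h : R -> R) (a b M : R) : (a <= b)%R -> measurable_fun setT h ->
  (forall x, 0 <= h x <= M)%R ->
  \int[mu]_(x in `[a, b]) (h x)%:E <= (M * (b - a))%R%:E.
Proof.
move=> ab mh hM.
apply: (@le_trans _ _ (\int[mu]_(x in `[a, b]) cst M%:E x)).
  apply: ge0_le_integral => //.
  - by move=> x _; rewrite lee_fin; case/andP: (hM x).
  - by apply: measurable_funTS; exact/measurable_EFinP.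
  - by move=> x _; rewrite lee_fin; case/andP: (hM x).
rewrite integral_cst//= lebesgue_measure_itv/= lte_fin.
by case: ltP => h1; rewrite -?EFinD -?EFinM// (_ : b - a = 0)%R ?mulr0 ?mule0//; lra.
Qed.

Lemma integral_ge_cst (h : R -> R) (a b m : R) : (a <= b)%R -> (0 <= m)%R ->
  measurable_fun setT h ->
  (forall x, m <= h x)%R ->
  (m * (b - a))%R%:E <= \int[mu]_(x in `[a, b]) (h x)%:E.
Proof.
move=> ab m0 mh hm.
apply: (@le_trans _ _ (\int[mu]_(x in `[a, b]) cst m%:E x)); last first.
  apply: ge0_le_integral => //.
  - by apply: measurable_funTS; exact/measurable_EFinP.
  - by move=> x _; rewrite lee_fin.
rewrite integral_cst//= lebesgue_measure_itv/= lte_fin.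
by case: ltP => h1; rewrite -?EFinD -?EFinM// (_ : b - a = 0)%R ?mulr0 ?mule0//; lra.
Qed.

(** The difference of two translates integrates to the difference of two
    integrals over windows of length [2 d], one around [pi] and one around [0]. *)
Lemma integral_half_period (K : R -> R) (M m d : R) : measurable_fun setT K ->
  (0 <= m)%R -> (forall x, m <= K x <= M)%R -> (0 <= d <= pi / 2)%R ->
  (forall x, 0 <= x <= pi -> K (x - d) <= K (x + d))%R ->
  \int[mu]_(x in `[0%R, pi]) (K (x + d) - K (x - d))%R%:E <= (2 * d * (M - m))%R%:E.
Proof.
move=> mK m0 KM /andP[d0 dpi] Kmono.
have K0 x : (0 <= K x <= M)%R.
  by case/andP: (KM x) => h ->; rewrite (le_trans m0 h).
have pi0 := @pi_ge0 R.
have mKe : measurable_fun setT (EFin \o K) by exact/measurable_EFinP.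
have Ke0 x : 0 <= (EFin \o K) x by rewrite lee_fin; case/andP: (K0 x).
have mKd : measurable_fun setT (fun x : R => K (x + d)%R).
  by apply: (measurableT_comp mK); exact: measurable_funD.
have mKd' : measurable_fun setT (fun x : R => K (x - d)%R).
  by apply: (measurableT_comp mK); exact: measurable_funB.
set X := \int[mu]_(x in _) _.
have X0 : 0 <= X by apply: integral_ge0 => x /=; rewrite in_itv/= => x0;
  rewrite lee_fin subr_ge0 Kmono.
(* The term with [x - d] is moved across, where all integrals are nonnegative. *)
have E1 : X + \int[mu]_(x in `[(- d)%R, (pi - d)%R]) (K x)%:E =
  \int[mu]_(x in `[d, (pi + d)%R]) (K x)%:E.
  rewrite -(@ge0_integral_shift R `[0%R, pi] _ (- d)%R (EFin \o K))//; last first.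
    by move=> x; rewrite !in_itv/=; apply/andP/andP => -[? ?]; split; lra.
  rewrite -(@ge0_integral_shift R `[0%R, pi] `[d, (pi + d)%R] d (EFin \o K))//;
    last first.
    by move=> x; rewrite !in_itv/=; apply/andP/andP => -[? ?]; split; lra.
  rewrite /X -ge0_integralD//.
  - by apply: eq_integral => x _; rewrite /= -EFinD subrK.
  - by move=> x /=; rewrite in_itv/= => x0; rewrite lee_fin subr_ge0 Kmono.
  - by apply: measurable_funTS; apply/measurable_EFinP; exact: measurable_funB.
  - by apply: measurable_funTS; apply/measurable_EFinP.
move: E1; rewrite (@ge0_integral_itvU R (- d)%R d (pi - d)%R (EFin \o K))//; [|lra|lra].
rewrite (@ge0_integral_itvU R d (pi - d)%R (pi + d)%R (EFin \o K))//; [|lra|lra].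
have [A EA] := ge0_integral_EFin_fin (- d)%R d mK K0.
have [B EB] := ge0_integral_EFin_fin d (pi - d)%R mK K0.
have [C EC] := ge0_integral_EFin_fin (pi - d)%R (pi + d)%R mK K0.
have hA : (m * (d - - d) <= A)%R.
  rewrite -lee_fin -EA; apply: integral_ge_cst => //; [by lra|by move=> x;
    case/andP: (KM x)].
have hC : (C <= M * ((pi + d) - (pi - d)))%R.
  rewrite -lee_fin -EC; by apply: integral_le_cst => //; lra.
rewrite /comp EA EB EC => E1.
move: X0 E1; case: X => [x| |]//.
rewrite -!EFinD => _ [E1]; rewrite lee_fin.
lra.
Qed.

(** As a function of the longitude, [k (s * cos p)] is even and periodic and rises
    on the half period [[0, pi]], so its total variation is twice its range, and
    the [L^1] norm of a difference of translates is at most the shift times the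
    variation. *)
Lemma latitude_modulus (k : R -> R) (M s d : R) :
  {homo k : x y /~ (x <= y)%R} -> (forall x, 0 <= k x <= M)%R ->
  (0 <= s)%R -> (0 <= d <= pi)%R ->
  \int[mu]_(p in `[0%R, (2 * pi)%R]) `|k (s * cos p) - k (s * cos (p - d))|%R%:E <=
  (2 * d * (k (- s) - k s))%R%:E.
Proof.
move=> hk kM s0 /andP[d0 dpi].
have pi0 := @pi_ge0 R.
have mk : measurable_fun setT k by apply: nonincreasing_measurable => // x y; exact: hk.
(* Centring the shift makes the integrand symmetric about [0] and [pi]. *)
pose h := (d / 2)%R.
pose K (p : R) := k (s * cos p)%R.
have mK : measurable_fun setT K.
  apply: (measurableT_comp mk); apply: measurable_funM => //; exact: measurable_cos.
pose g p : R := `|K (p + h) - K (p - h)|%R.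
have mg : measurable_fun setT (EFin \o g).
  apply/measurable_EFinP; apply: measurableT_comp => //; apply: measurable_funB.
    by apply: (measurableT_comp mK); exact: measurable_funD.
  by apply: (measurableT_comp mK); exact: measurable_funB.
have g0 p : 0 <= (EFin \o g) p by rewrite lee_fin normr_ge0.
have e2 : (2 * pi = pi *+ 2 :> R)%R by rewrite mulr_natl.
have Kper p : K (p + 2 * pi)%R = K p by rewrite /K e2 cosD2pi.
have Keven p : K (- p)%R = K p by rewrite /K cosN.
pose g' p : R := `|K p - K (p - d)|%R.
have mg' : measurable_fun setT (EFin \o g').
  apply/measurable_EFinP; apply: measurableT_comp => //; apply: measurable_funB => //.
  by apply: (measurableT_comp mK); exact: measurable_funB.
have -> : \int[mu]_(p in `[0%R, (2 * pi)%R]) `|k (s * cos p) - k (s * cos (p - d))|%R%:E =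
   \int[mu]_(p in `[0%R, (2 * pi)%R]) (EFin \o g) p.
  transitivity (\int[mu]_(p in `[0%R, (2 * pi)%R]) (EFin \o g') p); first by [].
  rewrite -(@ge0_integral_periodic R (2 * pi)%R h (EFin \o g'))//.
  - apply: eq_integral => p _; rewrite /= /g /g'; congr (`|K _ - K _|%R%:E).
    by rewrite /h; field.
  - by rewrite /h; apply/andP; split; lra.
  - by move=> p; rewrite lee_fin normr_ge0.
  - by move=> p; rewrite /= /g' Kper addrAC Kper.
have Kmono x : (0 <= x <= pi -> K (x - h) <= K (x + h))%R.
  move=> x0; apply: hk; rewrite ler_wpM2l// cosD cosB.
  have := sin_ge0_pi x0; have : (0 <= sin h)%R by apply: sin_ge0_pi; rewrite /h;
    apply/andP; split; lra.
  by nra.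
rewrite (@ge0_integral_itvU R 0%R pi (2 * pi)%R _)//; [|lra].
rewrite -[X in _ + X](@ge0_integral_reflect R `[0%R, pi] _ (2 * pi)%R)//; last first.
  by move=> x; rewrite !in_itv/=; apply/andP/andP => -[? ?]; split; lra.
have -> : \int[mu]_(x in `[0%R, pi]) (EFin \o g) (2 * pi - x)%R =
  \int[mu]_(x in `[0%R, pi]) (EFin \o g) x.
  apply: eq_integral => x _; rewrite /= /g distrC; congr (`|_ - _|%R%:E).
    by rewrite -Keven -[LHS]Kper; congr K; ring.
  by rewrite -Keven -[LHS]Kper; congr K; ring.
have H : \int[mu]_(x in `[0%R, pi]) (EFin \o g) x <= (2 * h * (k (- s) - k s))%R%:E.
  have -> : \int[mu]_(x in `[0%R, pi]) (EFin \o g) x =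
    \int[mu]_(x in `[0%R, pi]) (K (x + h) - K (x - h))%R%:E.
    apply: eq_integral => x /set_mem; rewrite /= in_itv/= => x0.
    by rewrite /g ger0_norm// subr_ge0 Kmono.
  apply: (@integral_half_period K (k (- s)%R) (k s) h) => //.
  - by case/andP: (kM s).
  - move=> x; apply/andP; split; apply: hk.
      by rewrite ler_piMr// cos_le1.
    by rewrite -mulrN1 ler_wpM2l// cos_geN1.
  - by rewrite /h; apply/andP; split; lra.
apply: (le_trans (leeD H H)); rewrite -EFinD lee_fin /h.
have -> : (2 * (d / 2) = d)%R by field.
lra.
Qed.

(** Up to the factor [2 pi] this is the integral over [[0, c]] of the area of the cap
    of radius [r], namely [2 pi (1 - cos r)]. *)
Lemma integral_ramp_sin (c : R) : (0 <= c <= pi)%R ->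
  \int[mu]_(t in `[0%R, pi]) (Num.max (c - t) 0 * sin t)%R%:E = (c - sin c)%R%:E.
Proof.
move=> /andP[c0 cpi].
have mr : measurable_fun setT (fun t : R => (Num.max (c - t) 0 * sin t)%R%:E).
  apply/measurable_EFinP; apply: measurable_funM; last exact: measurable_sin.
  by apply: measurable_maxr => //; exact: measurable_funB.
transitivity (\int[mu]_(t in `[0%R, c]) ((c - t) * sin t)%R%:E).
  rewrite integral_mkcond [RHS]integral_mkcond; apply: eq_integral => t _.
  rewrite !patchE !mem_setE !in_itv/=; case: (leP 0%R t) => //= t0.
  case: (leP t c) => tc.
    by rewrite (le_trans tc cpi) max_l// subr_ge0.
  by case: ifP => // _; rewrite max_r ?mul0r// subr_le0 ltW.
have dF (x : R) : is_derive x (1%R : R) (fun t =>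
  - ((c - t) * cos t) - sin t)%R ((c - x) * sin x)%R.
  by apply: is_derive_eq; rewrite /= /GRing.scale/=; ring.
rewrite (integral_antiderivative _ _ dF)//.
  by rewrite subrr mul0r oppr0 sub0r sin0 cos0; congr EFin; ring.
move=> x; apply: cvgM; last exact: continuous_sin.
by apply: cvgB; [exact: cvg_cst|exact: cvg_id].
Qed.

End modulus.

(** * Normal form of a pair of points *)

Section normal_form.
Context {R : realType}.
Implicit Types (p q : R * R * R).

Lemma polar_angle (a b : R) : exists c,
  [/\ 0 <= c <= 2 * pi, a = Num.sqrt (a ^+ 2 + b ^+ 2) * cos c &
      b = Num.sqrt (a ^+ 2 + b ^+ 2) * sin c].
Proof.
set r := Num.sqrt _.
have pi0 := @pi_ge0 R.
have ab0 : 0 <= a ^+ 2 + b ^+ 2 by rewrite addr_ge0 ?sqr_ge0.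
have rr : r ^+ 2 = a ^+ 2 + b ^+ 2 by rewrite sqr_sqrtr.
have [r0|r0] := eqVneq r 0.
  exists 0; rewrite cos0 sin0 lexx mulr_ge0//; split => //; rewrite r0.
    by move: rr; rewrite r0 => rr; nra.
  by move: rr; rewrite r0 => rr; nra.
have {}r0 : 0 < r by rewrite lt_def r0 sqrtr_ge0.
have hr : -1 <= a / r <= 1.
  rewrite ler_pdivlMr// ler_pdivrMr//; apply/andP; split; nra.
have rcos : r * cos (acos (a / r)) = a.
  by rewrite acosK ?in_itv// mulrC divfK ?gt_eqF.
have rsin : r * sin (acos (a / r)) = `|b|.
  have s0 : 0 <= sin (acos (a / r)) by apply: sin_ge0_pi; rewrite acos_ge0// acos_lepi.
  apply/eqP; rewrite -(@eqrXn2 _ 2)// ?mulr_ge0 ?(ltW r0)//.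
  by rewrite exprMn sin2cos2 mulrBr mulr1 -exprMn rcos rr -normrX ger0_norm ?sqr_ge0//
    addrAC subrr add0r.
have [b0|b0] := leP 0 b.
  exists (acos (a / r)); rewrite rcos rsin ger0_norm//; split => //.
  by rewrite acos_ge0//=; have := acos_lepi hr; lra.
exists (2 * pi - acos (a / r)).
have e2 : 2 * pi = pi *+ 2 :> R by rewrite mulr_natl.
rewrite e2 cosB sinB cos2pi sin2pi !mul1r !mul0r addr0 sub0r mulrN rcos rsin.
rewrite ltr0_norm// opprK -e2; split => //.
by have := acos_lepi hr; have := acos_ge0 hr; move=> h1 h2; apply/andP; split; lra.
Qed.

Definition dot3 p q : R := p.1.1 * q.1.1 + p.1.2 * q.1.2 + p.2 * q.2.

(** For points [p] and [q] of the sphere this depends only on their scalar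
    product, by rotation invariance ([two_point_normal_form]). *)
Definition two_point (Psi : R -> R -> R) p q : \bar R :=
  sphere_lint (fun x y z => Psi (dot3 (x, y, z) p) (dot3 (x, y, z) q)).

Definition rotate_pt c p : R * R * R :=
  (p.1.1 * cos c + p.1.2 * sin c, p.1.2 * cos c - p.1.1 * sin c, p.2).
Definition swap_pt p : R * R * R := (p.2, p.1.2, p.1.1).

Lemma dot3_rotate_pt c p q : dot3 (rotate_pt c p) (rotate_pt c q) = dot3 p q.
Proof.
rewrite /dot3 /rotate_pt/=; have := cos2Dsin2 c => cs.
rewrite -[p.1.1 * q.1.1]mul1r -[p.1.2 * q.1.2]mul1r -cs; ring.
Qed.

Lemma dot3_swap_pt p q : dot3 (swap_pt p) (swap_pt q) = dot3 p q.
Proof. rewrite /dot3 /swap_pt/=; ring. Qed.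

Section psi.
Variable (Psi : R -> R -> R).
Hypothesis mPsi : measurable_fun setT (fun w : R * R => Psi w.1 w.2).
Hypothesis Psi0 : forall u v, 0 <= Psi u v.

Lemma measurable_dot3 p : measurable_fun setT (fun w : R * R * R => dot3 w p).
Proof.
apply: measurable_funD; first apply: measurable_funD; apply: measurable_funM => //.
- exact: (measurableT_comp measurable_fst measurable_fst).
- exact: (measurableT_comp measurable_snd measurable_fst).
Qed.

Lemma measurable3_two_point p q :
  measurable3 (fun x y z => Psi (dot3 (x, y, z) p) (dot3 (x, y, z) q)).
Proof.
pose g (w : R * R * R) := (dot3 w p, dot3 w q).
have mg : measurable_fun setT g by apply: measurable_fun_pair; exact: measurable_dot3.
rewrite /measurable3.
rewrite (_ : (fun w : R * R * R => _) = (fun w => Psi w.1 w.2) \o g); last first.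
  by apply/funext => -[[x y] z].
exact: (measurableT_comp mPsi mg).
Qed.

Lemma two_point_rotate c p q : 0 <= c <= 2 * pi ->
  two_point Psi (rotate_pt c p) (rotate_pt c q) = two_point Psi p q.
Proof.
move=> c0; apply: etrans (sphere_lint_rotate c0 (measurable3_two_point p q)
  (fun x y z => Psi0 _ _)).
congr sphere_lint; apply/funext => x; apply/funext => y; apply/funext => z.
by rewrite /rotate_xy /dot3 /rotate_pt /=; congr Psi; ring.
Qed.

Lemma two_point_swap p q : two_point Psi (swap_pt p) (swap_pt q) = two_point Psi p q.
Proof.
apply: etrans (sphere_lint_swap (measurable3_two_point p q) (fun x y z => Psi0 _ _)).
congr sphere_lint; apply/funext => x; apply/funext => y; apply/funext => z.
by rewrite /swap_xz /dot3 /swap_pt /=; congr Psi; ring.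
Qed.

(** The rotations about the polar axis and the exchange of two axes generate
    enough isometries to bring any pair of points to the equator: [p] is turned
    to [(0, r, p_z)], exchanged to [(p_z, r, 0)] and turned to [(1, 0, 0)]; after
    another exchange [p] is the pole, and turning about it moves [q] without
    moving [p]. *)
Lemma two_point_normal_form p q : dot3 p p = 1 -> dot3 q q = 1 ->
  two_point Psi p q =
  two_point Psi (1, 0, 0) (dot3 p q, Num.sqrt (1 - dot3 p q ^+ 2), 0).
Proof.
move=> pp qq; set d := dot3 p q.
have rot_to (v : R * R * R) : exists2 c, 0 <= c <= 2 * pi &
    rotate_pt c v = (Num.sqrt (v.1.1 ^+ 2 + v.1.2 ^+ 2), 0, v.2).
  have [c [c0 ha hb]] := polar_angle v.1.1 v.1.2.
  exists c => //; rewrite /rotate_pt; set r := Num.sqrt _ in ha hb *; congr (_, _, _).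
    by rewrite {1}ha {1}hb -!mulrA -mulrDr -!expr2 cos2Dsin2 mulr1.
  by rewrite {1}hb {1}ha; ring.
have rot_y (v : R * R * R) : exists2 c, 0 <= c <= 2 * pi &
    rotate_pt c v = (0, Num.sqrt (v.1.1 ^+ 2 + v.1.2 ^+ 2), v.2).
  have [c [c0 hb ha]] := polar_angle v.1.2 (- v.1.1).
  move: hb ha; rewrite sqrrN addrC => hb ha.
  set r := Num.sqrt _ in ha hb *.
  have {}ha : v.1.1 = - (r * sin c) by rewrite -ha opprK.
  exists c => //; rewrite /rotate_pt; congr (_, _, _).
    by rewrite {1}ha {1}hb; ring.
  by rewrite {1}hb {1}ha mulNr opprK -!mulrA -mulrDr -!expr2 cos2Dsin2 mulr1.
have [c1 c10 r1] := rot_y p.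
pose p2 := swap_pt (rotate_pt c1 p); pose q2 := swap_pt (rotate_pt c1 q).
have [c2 c20 r2] := rot_to p2.
have p3E : rotate_pt c2 p2 = (1, 0, 0).
  rewrite r2 /p2 r1 /swap_pt/=; congr (_, _, _).
  rewrite sqr_sqrtr ?addr_ge0 ?sqr_ge0//.
  rewrite (_ : _ + _ = 1) ?sqrtr1// -pp /dot3; ring.
pose q3 := rotate_pt c2 q2.
have [c3 c30 r3] := rot_y (swap_pt q3).
rewrite -(two_point_rotate p q c10) -(two_point_swap (rotate_pt c1 p)) -/p2 -/q2.
rewrite -(two_point_rotate p2 q2 c20) p3E -/q3 -(two_point_swap (1, 0, 0) q3).
rewrite -(two_point_rotate (swap_pt (1, 0, 0)) (swap_pt q3) c30).
rewrite -(two_point_swap (rotate_pt c3 (swap_pt (1, 0, 0)))).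
have d3 : dot3 (1, 0, 0) q3 = d.
  by rewrite -p3E dot3_rotate_pt dot3_swap_pt dot3_rotate_pt.
have q33 : dot3 q3 q3 = 1 by rewrite dot3_rotate_pt dot3_swap_pt dot3_rotate_pt.
clearbody q3; have q31 : q3.1.1 = d by rewrite -d3 /dot3/= mul1r !mul0r !addr0.
have {}q33 : q3.2 ^+ 2 + q3.1.2 ^+ 2 = 1 - d ^+ 2.
  by rewrite -q33 /dot3 q31; ring.
by rewrite r3 /swap_pt/rotate_pt/= q31 q33 !mul0r subr0 !addr0.
Qed.
End psi.
End normal_form.

(** * Capped angular distance *)

Section caps.
Context {R : realType}.
Notation mu := (@lebesgue_measure R).
Implicit Types (p q : R * R * R).

(** Clamping makes [angle] monotone on the whole line, hence measurable. *)
Definition angle (u : R) : R := acos (Num.max (-1) (Num.min 1 u)).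
Definition capped (tau u : R) : R := Num.min (angle u) tau.

Lemma clamp_itv (u : R) : -1 <= Num.max (-1) (Num.min 1 u) <= 1.
Proof. by rewrite le_max lexx ge_max ge_min lexx /= andbT; lra. Qed.

Lemma angle_ge0 u : 0 <= angle u.
Proof. exact/acos_ge0/clamp_itv. Qed.

Lemma angleE u : -1 <= u <= 1 -> angle u = acos u.
Proof. by move=> /andP[h1 h2]; rewrite /angle min_r// max_r. Qed.

Lemma angle_cos t : 0 <= t <= pi -> angle (cos t) = t.
Proof. by move=> t0; rewrite angleE ?cos_geN1 ?cos_le1// cosK// in_itv. Qed.

Lemma angle_homo : {homo angle : x y /~ x <= y}.
Proof.
move=> x y xy; rewrite /angle acos_le ?clamp_itv//; last first.
  by rewrite acos_ge0 ?acos_lepi ?clamp_itv.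
rewrite acosK ?in_itv/= ?clamp_itv//.
by rewrite ge_max le_max lexx/= le_max le_min !ge_min lexx xy !orbT.
Qed.

Lemma capped_homo tau : {homo capped tau : x y /~ x <= y}.
Proof.
move=> x y /angle_homo xy; rewrite /capped le_min ge_min xy/=.
by rewrite ge_min lexx orbT.
Qed.

Lemma capped_itv tau u : 0 <= tau -> 0 <= capped tau u <= tau.
Proof. by move=> t0; rewrite /capped le_min angle_ge0 t0 ge_min lexx orbT. Qed.

Lemma measurable_angle : measurable_fun [set: R] angle.
Proof. by apply: nonincreasing_measurable => // x y; exact: angle_homo. Qed.

Lemma measurable_capped tau : measurable_fun [set: R] (capped tau).
Proof. by apply: nonincreasing_measurable => // x y; exact: capped_homo. Qed.

(** At colatitude [t] the distance to a point of the equator ranges over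
    [[|pi/2 - t|, pi - |pi/2 - t|]]; cut at [tau], its range has the length of a
    hat function of [t], which is a second difference of ramps. This reduces
    its integral to [integral_ramp_sin]. *)
Lemma capped_sin tau t : 0 <= tau <= pi / 2 -> 0 <= t <= pi ->
  capped tau (- sin t) - capped tau (sin t) =
  Num.max (pi / 2 + tau - t) 0 - 2 * Num.max (pi / 2 - t) 0 +
    Num.max (pi / 2 - tau - t) 0.
Proof.
move=> /andP[tau0 taupi] /andP[t0 tpi].
have as_ : angle (sin t) = `|pi / 2 - t|.
  rewrite -cosBpihalf -cos_norm distrC angle_cos// normr_ge0/= ler_norml.
  by apply/andP; split; lra.
have asN : angle (- sin t) = pi - `|pi / 2 - t|.
  rewrite -as_ !angleE ?sin_geN1 ?sin_le1 ?acosN ?sin_geN1 ?sin_le1//.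
  by rewrite lerN2 sin_le1 lerNl sin_geN1.
rewrite /capped as_ asN.
have -> : Num.min (pi - `|pi / 2 - t|) tau = tau.
  by apply: min_r; rewrite lerBrDl -lerBrDr ler_norml; apply/andP; split; lra.
rewrite /Num.max /Num.min.
case: (ler0P (pi / 2 - t)) => h; repeat case: ifP => //; lra.
Qed.

Local Open Scope ereal_scope.

Lemma measurable_partial_integral (B : set R) (h : R -> R -> \bar R) : measurable B ->
  measurable_fun setT (fun z : R * R => h z.1 z.2) ->
  (forall x y, B y -> 0 <= h x y) ->
  measurable_fun setT (fun x => \int[mu]_(y in B) h x y).
Proof.
move=> mB mh h0.
pose g : R * R -> \bar R := (fun z => h z.1 z.2) \_ (setT `*` B).
have mg : measurable_fun setT g.
  by apply/(measurable_restrictT _ _).1; [exact: measurableX|exact: measurable_funTS].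
have g0 z : 0 <= g z by apply: erestrict_ge0 => -[x y] [_ /= By]; exact: h0.
have := @measurable_fun_fubini_tonelli_F _ _ _ _ R mu g mg g0.
rewrite /fubini_F; apply: eq_measurable_fun => x _.
rewrite [RHS]integral_mkcond; apply: eq_integral => y _.
rewrite /g !patchE; congr (if _ then _ else _).
by apply/idP/idP => /set_mem => [[_ /mem_set]|By]//; apply/mem_set; split.
Qed.

Lemma integral_hat (tau : R) : (0 <= tau <= pi / 2)%R ->
  \int[mu]_(t in `[0%R, pi]) ((capped tau (- sin t) - capped tau (sin t)) * sin t)%R%:E =
  (2 * (1 - cos tau))%R%:E.
Proof.
move=> tau0; have pi0 := @pi_ge0 R.
pose ramp c (t : R) := (Num.max (c - t) 0 * sin t)%R%:E.
pose hat (t : R) := ((capped tau (- sin t) - capped tau (sin t)) * sin t)%R%:E.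
have mramp c : measurable_fun setT (ramp c).
  apply/measurable_EFinP; apply: measurable_funM; last exact: measurable_sin.
  by apply: measurable_maxr => //; exact: measurable_funB.
have ramp0 c t : `[0%R, pi]%classic t -> 0 <= ramp c t.
  by rewrite /= in_itv/= => t0; rewrite lee_fin mulr_ge0 ?sin_ge0_pi// le_max lexx orbT.
have mhat : measurable_fun setT hat.
  apply/measurable_EFinP; apply: measurable_funM; last exact: measurable_sin.
  apply: measurable_funB; apply: (measurableT_comp (measurable_capped tau));
    last exact: measurable_sin.
  by apply: measurableT_comp => //; exact: measurable_sin.
have hat0 t : `[0%R, pi]%classic t -> 0 <= hat t.
  rewrite /= in_itv/= => t0; rewrite lee_fin mulr_ge0 ?sin_ge0_pi// subr_ge0
    capped_homo//.
  by have := sin_ge0_pi t0; lra.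
have I c : (0 <= c <= pi)%R -> \int[mu]_(t in `[0%R, pi]) ramp c t = (c - sin c)%R%:E.
  exact: integral_ramp_sin.
have E : \int[mu]_(t in `[0%R, pi]) hat t +
    (\int[mu]_(t in `[0%R, pi]) ramp (pi / 2)%R t +
    \int[mu]_(t in `[0%R, pi]) ramp (pi / 2)%R t) =
    \int[mu]_(t in `[0%R, pi]) ramp (pi / 2 + tau)%R t +
    \int[mu]_(t in `[0%R, pi]) ramp (pi / 2 - tau)%R t.
  have mT c : measurable_fun `[0%R, pi] (ramp c) by exact: measurable_funTS.
  have mTh : measurable_fun `[0%R, pi] hat by exact: measurable_funTS.
  have sum0 t : `[0%R, pi]%classic t -> 0 <= ramp (pi / 2)%R t + ramp (pi / 2)%R t.
    by move=> t0; rewrite adde_ge0// ramp0.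
  rewrite -!ge0_integralD//; try exact: mT; try exact: ramp0; try exact: sum0;
    [|by apply: emeasurable_funD; exact: mT].
  apply: eq_integral => t /set_mem /=; rewrite in_itv/= => t0.
  by rewrite /hat /ramp capped_sin// -!EFinD; congr EFin; ring.
move: E; rewrite !I; [|by case/andP: tau0 => ? ?; apply/andP; split; lra..].
rewrite /hat -!EFinD => E.
have : \int[mu]_(t in `[0%R, pi]) hat t = (2 * (1 - cos tau))%R%:E.
  move: E; case: (\int[mu]_(t in `[0%R, pi]) hat t) => [r| |]//.
  rewrite -!EFinD => -[E]; congr EFin; move: E.
  rewrite sin_pihalf sinD sinB sin_pihalf cos_pihalf; lra.
by [].
Qed.

End caps.

(** * Integrals of the capped distance and of zonal functions *)

Section estimates.
Context {R : realType}.
Notation mu := (@lebesgue_measure R).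
Implicit Types (p q : R * R * R).
Local Open Scope ereal_scope.

Lemma dot3_itv p q : dot3 p p = 1%R -> dot3 q q = 1%R -> (-1 <= dot3 p q <= 1)%R.
Proof.
case: p q => [[a b] c] [[x y] z]; rewrite /dot3/= => h1 h2.
have := sqr_ge0 (a - x)%R; have := sqr_ge0 (b - y)%R; have := sqr_ge0 (c - z)%R.
have := sqr_ge0 (a + x)%R; have := sqr_ge0 (b + y)%R; have := sqr_ge0 (c + z)%R.
by move=> *; apply/andP; split; nra.
Qed.

(** The mean speed of the capped distance. With both points on the equator, the
    integral over each circle of latitude is controlled by [latitude_modulus],
    and the ranges of the capped distance on these circles add up to
    [integral_hat]. The constant is sharp: [4 (1 - cos tau)] is the integral of
    [|cos|] of the direction over the cap of radius [tau]. *)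
Lemma two_point_capped_le tau p q : (0 <= tau <= pi / 2)%R ->
  dot3 p p = 1%R -> dot3 q q = 1%R ->
  two_point (fun u v => `|capped tau u - capped tau v|%R) p q <=
  (4 * (1 - cos tau) * acos (dot3 p q))%R%:E.
Proof.
move=> tau0 pp qq; have pi0 := @pi_ge0 R.
have tau00 : (0 <= tau)%R by case/andP: tau0.
have mPsi : measurable_fun setT (fun w : R * R => `|capped tau w.1 - capped tau w.2|%R).
  apply: measurableT_comp => //; apply: measurable_funB.
    by apply: (measurableT_comp (measurable_capped tau)).
  by apply: (measurableT_comp (measurable_capped tau)).
rewrite two_point_normal_form//.
have dI := dot3_itv pp qq; set d := dot3 p q in dI *.
have -> : Num.sqrt (1 - d ^+ 2) = sin (acos d) by rewrite sin_acos.
have {1}-> : d = cos (acos d) by rewrite acosK ?in_itv.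
have del0 := acos_ge0 dI; have dle := acos_lepi dI.
set del := acos d in del0 dle *.
pose g (t ph : R) := `|capped tau (sin t * cos ph) - capped tau (sin t * cos (ph -
  del))|%R.
have mg : measurable_fun setT (fun w : R * R => (g w.1 w.2)%:E).
  apply/measurable_EFinP; apply: measurableT_comp => //.
  have m1 : measurable_fun setT (fun w : R * R => sin w.1).
    exact: (measurableT_comp measurable_sin).
  apply: measurable_funB; apply: (measurableT_comp (measurable_capped tau)).
    by apply: measurable_funM => //; exact: (measurableT_comp measurable_cos).
  apply: measurable_funM => //; apply: (measurableT_comp measurable_cos).
  exact: measurable_funB.
have g0 t ph : 0 <= (g t ph)%:E by rewrite lee_fin normr_ge0.
have -> : two_point (fun u v => `|capped tau u -
  capped tau v|%R) (1, 0, 0)%R (cos del, sin del, 0)%R =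
   \int[mu]_(t in `[0%R, pi]) ((\int[mu]_(ph in `[0%R, (2 * pi)%R]) (g t ph)%:E)
     * (sin t)%:E).
  apply: eq_integral => t /set_mem /=; rewrite in_itv/= => t0.
  rewrite -ge0_integralZr//; last 2 first.
  - apply: measurable_funTS; exact: (@measurable_section2 R (fun t ph => (g t ph)%:E)).
  - by rewrite lee_fin sin_ge0_pi.
  apply: eq_integral => ph _; rewrite -EFinM /g cosB /dot3/=;
    congr (`|capped _ _ - capped _ _| * _)%R%:E; ring.
apply: (@le_trans _ _ (\int[mu]_(t in `[0%R, pi]) ((2 * del)%:E * ((capped tau (- sin t)
  - capped tau (sin t)) * sin t)%R%:E))).
  apply: ge0_le_integral => //.
  - move=> t /=; rewrite in_itv/= => t0; apply: mule_ge0; first exact: integral_ge0.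
    by rewrite lee_fin sin_ge0_pi.
  - apply: measurable_funTS; apply: emeasurable_funM.
      exact: (@measurable_partial_integral R _ (fun t ph => (g t ph)%:E)).
    by apply/measurable_EFinP; exact: measurable_sin.
  - apply: measurable_funTS; apply/measurable_EFinP; apply: measurable_funM => //.
    apply: measurable_funM; last exact: measurable_sin.
    apply: measurable_funB; apply: (measurableT_comp (measurable_capped tau));
      last exact: measurable_sin.
    by apply: measurableT_comp => //; exact: measurable_sin.
  - move=> t /=; rewrite in_itv/= => t0.
    rewrite -EFinM mulrA [X in _ <= X]EFinM;
      have st : 0 <= (sin t)%:E by rewrite lee_fin sin_ge0_pi.
    apply: (lee_wpmul2r st).
    apply: (@latitude_modulus R (capped tau) tau) => //.
    + exact: capped_homo.
    + by move=> x; exact: capped_itv.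
    + by rewrite del0.
have c0 (t : R) : (0 <= t <= pi)%R ->
  (0 <= (capped tau (- sin t) - capped tau (sin t)) * sin t)%R.
  move=> t0; rewrite mulr_ge0 ?sin_ge0_pi// subr_ge0 capped_homo//.
  by have := sin_ge0_pi t0; lra.
rewrite ge0_integralZl//.
- by rewrite integral_hat// -EFinM lee_fin; lra.
- apply: measurable_funTS; apply/measurable_EFinP; apply: measurable_funM;
  last exact: measurable_sin.
  apply: measurable_funB; apply: (measurableT_comp (measurable_capped tau));
    last exact: measurable_sin.
  by apply: measurableT_comp => //; exact: measurable_sin.
- by rewrite lee_fin mulr_ge0.
Qed.

Lemma zonal_integral (m : R -> R) p : measurable_fun setT m -> (forall u, 0 <= m u)%R ->
  dot3 p p = 1%R ->
  sphere_lint (fun x y z => m (dot3 (x, y, z) p)) =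
  (2 * pi)%R%:E * \int[mu]_(t in `[0%R, pi]) (m (cos t) * sin t)%R%:E.
Proof.
move=> mm m0 pp; have pi0 := @pi_ge0 R.
have mPsi : measurable_fun setT (fun w : R * R => m w.1) by exact: (measurableT_comp mm).
have Psi0 (u v : R) : (0 <= m u)%R by [].
have E := @two_point_normal_form R (fun u v => m u) mPsi Psi0 p p pp pp.
pose e : R * R * R := (1, 0, 0)%R.
have := @two_point_swap R (fun u v =>
  m u) mPsi Psi0 e (dot3 p p, Num.sqrt (1 - dot3 p p ^+ 2), 0)%R.
rewrite /e -E {1}/two_point /two_point => <-; rewrite /swap_pt/=.
rewrite -ge0_integralZl//; last 3 first.
- apply: measurable_funTS; apply/measurable_EFinP; apply: measurable_funM;
  last exact: measurable_sin.
  by apply: (measurableT_comp mm); exact: measurable_cos.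
- by move=> t /=; rewrite in_itv/= => t0; rewrite lee_fin mulr_ge0// sin_ge0_pi.
- by rewrite lee_fin mulr_ge0.
apply: eq_integral => t _.
transitivity (\int[mu]_(ph in `[0%R, (2 * pi)%R]) (cst (m (cos t) * sin t)%R%:E) ph).
  apply: eq_integral => ph _; congr (m _ * _)%R%:E; rewrite /dot3/=; ring.
rewrite integral_cst//= muleC; congr (_ * _).
rewrite lebesgue_measure_itv/= lte_fin.
by case: ltP => h; rewrite -?EFinD ?subr0//; congr EFin; apply/eqP;
  rewrite eq_le h mulr_ge0.
Qed.

Lemma sphere_lint_cst (a : R) : (0 <= a)%R ->
  sphere_lint (fun _ _ _ : R => a) = (4 * pi * a)%R%:E.
Proof.
move=> a0; have := @zonal_integral (cst a) (1, 0, 0)%R (measurable_cst _) (fun=> a0).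
rewrite /= => ->; last by rewrite /dot3/=; ring.
have dF (x : R) : is_derive x (1%R : R) (fun t => - (a * cos t))%R (a * sin x)%R.
  by apply: is_derive_eq; rewrite /= /GRing.scale/=; ring.
rewrite (integral_antiderivative _ _ dF) ?pi_ge0//.
  by rewrite -EFinM cospi cos0; congr EFin; ring.
by move=> x; apply: cvgM; [exact: cvg_cst|exact: continuous_sin].
Qed.

Lemma ramp_integral c p : (0 <= c <= pi)%R -> dot3 p p = 1%R ->
  sphere_lint (fun x y z => Num.max (c - angle (dot3 (x, y, z) p)) 0)%R =
  (2 * pi * (c - sin c))%R%:E.
Proof.
move=> c0 pp.
rewrite (@zonal_integral (fun u => Num.max (c - angle u) 0)%R)//; last 2 first.
- by apply: measurable_maxr => //; apply: measurable_funB => //; exact: measurable_angle.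
- by move=> u; rewrite le_max lexx orbT.
rewrite [RHS]EFinM -integral_ramp_sin//; congr (_ * _).
by apply: eq_integral => t /set_mem /=; rewrite in_itv/= => t0; rewrite angle_cos.
Qed.

End estimates.

(** * Additivity and monotonicity of the sphere integral *)

Section algebra.
Context {R : realType}.
Notation mu := (@lebesgue_measure R).
Local Open Scope ereal_scope.
Implicit Types f g : R -> R -> R -> R.

(** The integral of a nonnegative function is a supremum over the simple
    functions below it, and this supremum grows with the function. The distance
    to the curve is compared with measurable functions in this way. *)
Lemma ge0_le_integral_nonmeasurable d (T : measurableType d) (m : {measure set T ->
  \bar R})
    (D : set T) (f g : T -> \bar R) :
  (forall x, D x -> 0 <= f x) -> (forall x, D x -> f x <= g x) ->
  \int[m]_(x in D) f x <= \int[m]_(x in D) g x.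
Proof.
move=> f0 fg; rewrite integral_mkcond [leRHS]integral_mkcond !ge0_integralTE.
- apply: ereal_sup_le => _ [h /= hf <-]; exists h => // x.
  apply: (le_trans (hf x)); rewrite !patchE; case: ifPn => // /set_mem; exact: fg.
- by move=> x; apply: erestrict_ge0 => y Dy; exact: le_trans (f0 _ Dy) (fg _ Dy).
- by move=> x; exact: erestrict_ge0.
Qed.

Definition sphere_fun f (z : R * R) : R :=
  (f (sin z.2 * cos z.1) (sin z.2 * sin z.1) (cos z.2) * sin z.2)%R.

Definition sphere_dom : set (R * R) := `[0%R, (2 * pi)%R] `*` `[0%R, pi].

Lemma measurable_sphere_dom : measurable sphere_dom.
Proof. exact: measurableX. Qed.

Lemma measurable_sphere_fun f : measurable3 f ->
  measurable_fun setT (fun z => (sphere_fun f z)%:E).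
Proof.
move=> mf; apply/measurable_EFinP.
have m1 : measurable_fun setT (fun w : R * R => sin w.2).
  exact: (measurableT_comp measurable_sin).
apply: measurable_funM => //; apply: measurable3_comp => //.
- by apply: measurable_funM => //; exact: (measurableT_comp measurable_cos).
- by apply: measurable_funM => //; exact: (measurableT_comp measurable_sin).
- exact: (measurableT_comp measurable_cos).
Qed.

Lemma sphere_fun_ge0 f z : (forall x y z, 0 <= f x y z)%R -> sphere_dom z ->
  (0 <= sphere_fun f z)%R.
Proof.
by move=> f0 [_ /=]; rewrite in_itv/= => z2; rewrite /sphere_fun mulr_ge0 ?sin_ge0_pi.
Qed.

Lemma sphere_lintE f : measurable3 f -> (forall x y z, 0 <= f x y z)%R ->
  sphere_lint f = \int[mu \x mu]_(z in sphere_dom) (sphere_fun f z)%:E.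
Proof.
move=> mf f0; apply/esym.
apply: (@ge0_integral_setX2 R _ _ (fun p t => (sphere_fun f (p, t))%:E)) => //.
  rewrite (_ : (fun z : R * R => (sphere_fun f (z.1, z.2))%:E) =
    fun z => (sphere_fun f z)%:E).
    exact: measurable_sphere_fun.
  by apply/funext => -[].
by move=> x y hx hy; rewrite lee_fin sphere_fun_ge0.
Qed.

Lemma measurable3D f g : measurable3 f -> measurable3 g ->
  measurable3 (fun x y z => f x y z + g x y z)%R.
Proof. by move=> mf mg; exact: measurable_funD. Qed.

Lemma sphere_lintD f g : measurable3 f -> (forall x y z, 0 <= f x y z)%R ->
  measurable3 g -> (forall x y z, 0 <= g x y z)%R ->
  sphere_lint (fun x y z => f x y z + g x y z)%R = sphere_lint f + sphere_lint g.
Proof.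
move=> mf f0 mg g0; rewrite !sphere_lintE//; last 2 first.
- exact: measurable3D.
- by move=> x y z; rewrite addr_ge0.
rewrite -ge0_integralD//.
- by apply: eq_integral => z _; rewrite -EFinD /sphere_fun mulrDl.
- exact: measurable_sphere_dom.
- by move=> z hz; rewrite lee_fin sphere_fun_ge0.
- by apply: measurable_funTS; exact: measurable_sphere_fun.
- by move=> z hz; rewrite lee_fin sphere_fun_ge0.
- by apply: measurable_funTS; exact: measurable_sphere_fun.
Qed.

Lemma sphere_lint_sum (n : nat) (F : nat -> R -> R -> R -> R) :
  (forall i, measurable3 (F i)) -> (forall i x y z, 0 <= F i x y z)%R ->
  sphere_lint (fun x y z => \sum_(i < n) F i x y z)%R = \sum_(i < n) sphere_lint (F i) /\
  measurable3 (fun x y z => \sum_(i < n) F i x y z)%R.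
Proof.
move=> mF F0; elim: n => [|n [IH mS]].
  rewrite big_ord0; have e : (fun x y z : R => \sum_(i < 0) F i x y z)%R =
    fun _ _ _ => 0%R.
    by apply/funext => x; apply/funext => y; apply/funext => z; rewrite big_ord0.
  by rewrite e sphere_lint_cst// mulr0; split=> //; exact: measurable_cst.
have e : (fun x y z : R => \sum_(i < n.+1) F i x y z)%R =
  fun x y z => (\sum_(i < n) F i x y z + F n x y z)%R.
  by apply/funext => x; apply/funext => y; apply/funext => z; rewrite big_ord_recr.
rewrite e big_ord_recr/= -IH; split; last exact: measurable3D.
by apply: sphere_lintD => // x y z; exact: sumr_ge0.
Qed.

Lemma sphere_lintZ c f : (0 <= c)%R -> measurable3 f -> (forall x y z, 0 <= f x y z)%R ->
  sphere_lint (fun x y z => c * f x y z)%R = c%:E * sphere_lint f.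
Proof.
move=> c0 mf f0; rewrite !sphere_lintE//; last 2 first.
- exact: measurable_funM.
- by move=> x y z; rewrite mulr_ge0.
rewrite -ge0_integralZl//.
- by apply: eq_integral => z _; rewrite -EFinM /sphere_fun mulrA.
- exact: measurable_sphere_dom.
- by apply: measurable_funTS; exact: measurable_sphere_fun.
- by move=> z hz; rewrite lee_fin sphere_fun_ge0.
Qed.

Lemma sphere_lint_le f g : (forall x y z, 0 <= f x y z)%R ->
  (forall x y z, x ^+ 2 + y ^+ 2 + z ^+ 2 = 1 -> f x y z <= g x y z)%R ->
  sphere_lint f <= sphere_lint g.
Proof.
move=> f0 fg; apply: ge0_le_integral_nonmeasurable => t /=; rewrite in_itv/= => t0.
  by apply: integral_ge0 => p _; rewrite lee_fin mulr_ge0 ?sin_ge0_pi.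
apply: ge0_le_integral_nonmeasurable => p _;
  first by rewrite lee_fin mulr_ge0 ?sin_ge0_pi.
rewrite lee_fin ler_wpM2r ?sin_ge0_pi//; apply: fg.
by rewrite !exprMn -mulrDr cos2Dsin2 mulr1 addrC cos2Dsin2.
Qed.

(** The bound [M] ensures that the extended integral of [f] is finite, so that
    [sphere_integral f] is not a default value. *)
Lemma sphere_lint_le_sphere_integral (h : R -> R -> R -> R) (f : 'rV[R]_3 -> R) (M : R) :
  measurable3 h -> (forall x y z, 0 <= h x y z)%R ->
  (forall x y z, x ^+ 2 + y ^+ 2 + z ^+ 2 = 1 -> h x y z <= f (row3 x y z) <= M)%R ->
  sphere_lint h <= (sphere_integral f)%:E.
Proof.
move=> mh h0 hf; rewrite sphere_lintE// /sphere_integral /Rintegral.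
have sph (z : R * R) : ((sin z.2 * cos z.1) ^+ 2 + (sin z.2 * sin z.1) ^+ 2 +
  cos z.2 ^+ 2 = 1)%R.
  by rewrite !exprMn -mulrDr cos2Dsin2 mulr1 addrC cos2Dsin2.
have M0 : (0 <= M)%R.
  have /andP[h1 h2] := hf _ _ _ (sph (0, 0)%R).
  exact: le_trans (h0 _ _ _) (le_trans h1 h2).
have le1 : \int[mu \x mu]_(z in sphere_dom) (sphere_fun h z)%:E <=
    \int[mu \x mu]_(z in sphere_dom) (f (spherical_coord z) * sin z.2)%R%:E.
  apply: ge0_le_integral_nonmeasurable => z hz; first by rewrite lee_fin sphere_fun_ge0.
  move: hz => [_ /=]; rewrite in_itv/= => z2.
  rewrite lee_fin /sphere_fun ler_wpM2r ?sin_ge0_pi//.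
  by case/andP: (hf _ _ _ (sph z)).
have f0 z : sphere_dom z -> 0 <= (f (spherical_coord z) * sin z.2)%R%:E.
  move=> [_ /=]; rewrite in_itv/= => z2; rewrite lee_fin mulr_ge0 ?sin_ge0_pi//.
  by case/andP: (hf _ _ _ (sph z)) => + _; apply: le_trans; exact: h0.
have le2 : \int[mu \x mu]_(z in sphere_dom) (f (spherical_coord z) * sin z.2)%R%:E <=
    (4 * pi * M)%R%:E.
  rewrite -sphere_lint_cst// sphere_lintE//; last exact: measurable_cst.
  apply: ge0_le_integral_nonmeasurable => z hz; first exact: f0.
  move: hz => [_ /=]; rewrite in_itv/= => z2.
  rewrite lee_fin /sphere_fun ler_wpM2r ?sin_ge0_pi//.
  by case/andP: (hf _ _ _ (sph z)).
rewrite fineK// ge0_fin_numE; last exact: integral_ge0.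
exact: le_lt_trans le2 (ltry _).
Qed.

End algebra.

(** * Spherical geometry and continuity of the curve *)

Section spherical_geometry.
Context {R : realType}.
Implicit Types x y z : 'rV[R]_3.

Definition coords x : R * R * R :=
  (x 0 ord0, x 0 (lift ord0 ord0), x 0 (lift ord0 (lift ord0 ord0))).

Lemma dotE x y : dot x y = dot3 (coords x) (coords y).
Proof. by rewrite /dot !big_ord_recl big_ord0 addr0 addrA. Qed.

Lemma coords_row3 (a b c : R) : coords (row3 a b c) = (a, b, c).
Proof. by rewrite /coords /row3 !mxE. Qed.

Lemma dotC x y : dot x y = dot y x.
Proof. by rewrite !dotE /dot3; ring. Qed.

Lemma sphereP x : sphere R x -> dot x x = 1.
Proof.
rewrite /sphere/= /enorm => h.
have d0 : 0 <= dot x x by rewrite /dot; apply: sumr_ge0 => i _; exact: sqr_ge0.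
by rewrite -(sqr_sqrtr d0) h expr1n.
Qed.

Lemma sphere_row3 (a b c : R) : a ^+ 2 + b ^+ 2 + c ^+ 2 = 1 -> sphere R (row3 a b c).
Proof.
by move=> h; rewrite /sphere/= /enorm dotE coords_row3 /dot3/= -!expr2 h sqrtr1.
Qed.

Lemma dot_itv x y : sphere R x -> sphere R y -> -1 <= dot x y <= 1.
Proof. by move=> /sphereP hx /sphereP hy; rewrite dotE dot3_itv -?dotE. Qed.

(** The difference of the two sides is the Gram determinant of three unit
    vectors, the square of their determinant. *)
Lemma gram_ge0 x y z : sphere R x -> sphere R y -> sphere R z ->
  (dot x y * dot y z - dot x z) ^+ 2 <= (1 - dot x y ^+ 2) * (1 - dot y z ^+ 2).
Proof.
move=> /sphereP hx /sphereP hy /sphereP hz; move: hx hy hz; rewrite !dotE.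
case: (coords x) => [[a b] c]; case: (coords y) => [[d e] f];
  case: (coords z) => [[g h] i].
rewrite /dot3/= => hx hy hz; rewrite -subr_ge0.
suff -> : (1 - (a * d + b * e + c * f) ^+ 2) * (1 - (d * g + e * h + f * i) ^+ 2) -
  ((a * d + b * e + c * f) * (d * g + e * h + f * i) - (a * g + b * h + c * i)) ^+ 2 =
  (a * (e * i - f * h) - b * (d * i - f * g) + c * (d * h - e * g)) ^+ 2.
  exact: sqr_ge0.
set u := a * d + _ + _; set v := d * g + _ + _; set w := a * g + _ + _.
have -> : (1 - u ^+ 2) * (1 - v ^+ 2) - (u * v - w) ^+ 2 =
  1 * 1 * 1 - u ^+ 2 * 1 - v ^+ 2 * 1 - w ^+ 2 * 1 + 2 * u * v * w by ring.
rewrite -{1}hx -{2}hz -{1}hy -{1}hz -{1}hx -{1}hy /u /v /w; ring.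
Qed.

Lemma acos_triangle x y z : sphere R x -> sphere R y -> sphere R z ->
  acos (dot x z) <= acos (dot x y) + acos (dot y z).
Proof.
move=> hx hy hz.
have hxy := dot_itv hx hy; have hyz := dot_itv hy hz; have hxz := dot_itv hx hz.
have a0 := acos_ge0 hxy; have b0 := acos_ge0 hyz.
have [h|h] := leP pi (acos (dot x y) + acos (dot y z)).
  exact: le_trans (acos_lepi hxz) h.
rewrite acos_le//; last by rewrite addr_ge0//= ltW.
rewrite cosD !acosK ?in_itv//.
have sa0 : 0 <= sin (acos (dot x y)) by apply: sin_ge0_pi; rewrite a0 acos_lepi.
have sb0 : 0 <= sin (acos (dot y z)) by apply: sin_ge0_pi; rewrite b0 acos_lepi.
have g := gram_ge0 hx hy hz.
have sa : sin (acos (dot x y)) ^+ 2 = 1 - dot x y ^+ 2 by rewrite sin2cos2 acosK ?in_itv.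
have sb : sin (acos (dot y z)) ^+ 2 = 1 - dot y z ^+ 2 by rewrite sin2cos2 acosK ?in_itv.
move: g; rewrite -sa -sb -exprMn => g.
have /ler_normlP[_ ] : `|dot x y * dot y z - dot x z| <=
  sin (acos (dot x y)) * sin (acos (dot y z)).
  by rewrite -ler_sqr ?nnegrE ?mulr_ge0// -normrX ger0_norm ?sqr_ge0.
by lra.
Qed.

Lemma cos_lt1 (e : R) : 0 < e <= pi -> cos e < 1.
Proof.
move=> /andP[e0 epi]; rewrite -cos0 ltr_cos ?in_itv/= ?lexx ?pi_ge0 ?(ltW e0)//.
Qed.

Lemma dot_continuous x : continuous (dot x).
Proof.
have -> : dot x = (fun y => x 0 ord0 * y 0 ord0 +
  x 0 (lift ord0 ord0) * y 0 (lift ord0 ord0) +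
    x 0 (lift ord0 (lift ord0 ord0)) * y 0 (lift ord0 (lift ord0 ord0))).
  by apply/funext => y; rewrite dotE.
have H i : continuous (fun y : 'rV[R]_3 => x 0 i * y 0 i).
  move=> y; apply: (@continuousM _ _ (fun=> x 0 i) (fun y : 'rV[R]_3 => y 0 i)).
    exact: cst_continuous.
  exact: coord_continuous.
move=> y; apply: (@continuousD _ _ _ (fun y : 'rV[R]_3 => x 0 ord0 * y 0 ord0 +
  x 0 (lift ord0 ord0) * y 0 (lift ord0 ord0)) (fun y => x 0 _ * y 0 _)); last exact: H.
by apply: (@continuousD _ _ _ (fun y : 'rV[R]_3 => x 0 ord0 * y 0 ord0)
  (fun y => x 0 _ * y 0 _)); exact: H.
Qed.

Lemma curve_close_near (gamma : R -> 'rV[R]_3) (e t : R) :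
  {within `[0, 1], continuous gamma} ->
  (forall s, 0 <= s <= 1 -> sphere R (gamma s)) ->
  0 < e <= pi -> 0 <= t <= 1 ->
  \forall s \near t, 0 <= s <= 1 -> acos (dot (gamma t) (gamma s)) < e.
Proof.
move=> cg sg e0 t01.
have cd : {within `[0, 1], continuous (fun s => dot (gamma t) (gamma s))}.
  by move=> s; apply: continuous_comp; [exact: cg|exact: dot_continuous].
have tA : `[0, 1]%classic t by rewrite /= in_itv.
move/subspace_continuousP : cd => /(_ t tA) /cvgr_gt/(_ (cos e)).
rewrite [X in (_ < X) -> _](_ : _ = 1); last exact: (sphereP (sg _ t01)).
move=> /(_ (cos_lt1 e0)); rewrite near_withinE.
apply: filterS => s /= + s01; rewrite /= in_itv/= => /(_ s01) h.
have dI := dot_itv (sg _ t01) (sg _ s01).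
have eI : 0 <= e <= pi by case/andP: e0 => /ltW -> ->.
have eIn : e \in `[0, pi] by rewrite in_itv.
have aIn : acos (dot (gamma t) (gamma s))
  \in `[0, pi] by rewrite in_itv/= acos_ge0 ?acos_lepi.
by rewrite -(ltr_cos aIn eIn) acosK ?in_itv.
Qed.

(** Uniform continuity by compactness of the parameter interval. *)
Lemma curve_uniformly_close (gamma : R -> 'rV[R]_3) (e : R) :
  {within `[0, 1], continuous gamma} ->
  (forall s, 0 <= s <= 1 -> sphere R (gamma s)) -> 0 < e <= pi ->
  exists n : nat, forall s t, 0 <= s <= 1 -> 0 <= t <= 1 ->
    `|s - t| <= n.+1%:R^-1 -> acos (dot (gamma s) (gamma t)) <= e.
Proof.
move=> cg sg /andP[e0 epi].
have e2 : 0 < e / 2 <= pi by apply/andP; split; lra.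
have /compact_near_coveringP/near_covering_withinP H := @segment_compact R 0 1.
have [] := H nat \oo (fun n t => forall s, 0 <= s <= 1 ->
    `|s - t| <= n.+1%:R^-1 -> acos (dot (gamma s) (gamma t)) <= e) _.
  move=> x; rewrite /= in_itv/= => x01.
  have /nbhs_ballP[r /= r0 hr] := curve_close_near cg sg e2 x01.
  have r20 : 0 < r / 2 by rewrite divr_gt0.
  near=> x' n => /=; rewrite in_itv/= => x'01 s s01 sx'.
  have xx' : `|x - x'| < r / 2.
    by near: x'; exact: (nbhsx_ballx x (r / 2) r20).
  have nr : n.+1%:R^-1 < r / 2.
    by near: n; exact: (near_infty_natSinv_lt (PosNum r20)).
  have h1 : acos (dot (gamma x) (gamma x')) < e / 2.
    by apply: hr => //; rewrite /ball/=; lra.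
  have h2 : acos (dot (gamma x) (gamma s)) < e / 2.
    apply: hr => //; rewrite /ball/= distrC.
    have -> : s - x = (s - x') - (x - x') by ring.
    apply: (le_lt_trans (ler_normB _ _)); rewrite [X in _ < X](splitr r).
    by apply: ltrD => //; exact: le_lt_trans sx' nr.
  have := acos_triangle (sg _ s01) (sg _ x01) (sg _ x'01).
  by rewrite [dot (gamma s) (gamma x)]dotC; lra.
move=> n _ /(_ n (leqnn n)) hn; exists n => s t s01 t01; apply: hn => //=.
Unshelve. all: end_near. Qed.
End spherical_geometry.

(** * Inscribed polygons *)

Section discretization.
Context {R : realType}.

Lemma mulr_cos_le_sin (x : R) : 0 <= x <= pi -> x * cos x <= sin x.
Proof.
move=> /andP[x0 xpi].
have [|c] := @MVT_segment R sin cos 0 x x0.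
  by apply: continuous_subspaceT; exact: continuous_sin.
rewrite in_itv/= sin0 !subr0 => /andP[c0 cx] ->; rewrite mulrC ler_wpM2r//.
move: cx; rewrite le_eqVlt => /predU1P[->//|cx].
by apply: ltW; rewrite ltr_cos ?in_itv//= ?x0 ?c0//= (le_trans (ltW cx)).
Qed.

Lemma cos_ge (x : R) : 0 <= x -> 1 - x <= cos x.
Proof.
move=> x0; have [|c] := @MVT_segment R cos (fun y => - sin y) 0 x x0.
  by apply: continuous_subspaceT; exact: continuous_cos.
rewrite cos0 subr0 => _ h; have := sin_le1 c; nra.
Qed.

(** A chord of angle [d] has length [2 sin (d / 2)], and [h cos h <= sin h]. *)
Lemma angle_le_chord (x y : 'rV[R]_3) (e : R) : sphere R x -> sphere R y ->
  0 <= e <= pi / 2 -> acos (dot x y) <= e -> acos (dot x y) * cos e <= enorm (y - x).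
Proof.
move=> hx hy /andP[e0 epi] he; have pi0 := @pi_ge0 R.
have dI := dot_itv hx hy.
set d := acos (dot x y) in he *.
have d0 : 0 <= d by exact: acos_ge0.
have chord : enorm (y - x) = 2 * sin (d / 2).
  rewrite /enorm; have s0 : 0 <= 2 * sin (d / 2).
    by rewrite mulr_ge0// sin_ge0_pi//; apply/andP; split; lra.
  rewrite -[RHS](ger0_norm s0) -sqrtr_sqr; congr Num.sqrt.
  have cd : cos d = dot x y by rewrite acosK ?in_itv.
  have c2 : cos d = 1 - 2 * sin (d / 2) ^+ 2.
    rewrite {1}(splitr d) cosD -!expr2 cos2sin2; ring.
  have -> : (2 * sin (d / 2)) ^+ 2 = 2 - 2 * cos d by rewrite c2; ring.
  rewrite cd; have := sphereP hx; have := sphereP hy; rewrite !dotE /dot3 /coords !mxE/=.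
  by move=> h1 h2; lra.
rewrite chord.
have := @mulr_cos_le_sin (d / 2); have -> : 0 <= d / 2 <= pi by apply/andP; split; lra.
move=> /(_ isT) h.
have : cos e <= cos (d / 2).
  have : d / 2 <= e by lra.
  rewrite le_eqVlt => /predU1P[->//|de].
  by apply: ltW; rewrite ltr_cos ?in_itv//=; apply/andP; split; lra.
nra.
Qed.

(** A closed path of values goes from [a i] to [a j] and back. *)
Lemma cyclic_variation (a : nat -> R) (n i j : nat) : (i <= n)%N -> (j <= n)%N ->
  a 0 = a n -> 2 * (a j - a i) <= \sum_(k < n) `|a k.+1 - a k|.
Proof.
have tele m l : (m <= l)%N -> a l - a m <= \sum_(m <= k < l) `|a k.+1 - a k| /\
    a m - a l <= \sum_(m <= k < l) `|a k.+1 - a k|.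
  move=> ml; rewrite -telescope_sumr//; split.
    by apply: ler_sum => k _; exact: ler_norm.
  by rewrite -opprB -telescope_sumr// -sumrN; apply: ler_sum => k _;
    rewrite -normrN ler_norm.
move=> ilen jlen a0n.
rewrite -(big_mkord xpredT (fun k => `|a k.+1 - a k|)).
have [ij|/ltnW ji] := leqP i j.
  rewrite (big_cat_nat _ ilen)//= (big_cat_nat _ jlen)//=.
  have [h1 _] := tele _ _ ij; have [_ h2] := tele _ _ (leq0n i);
    have [_ h3] := tele _ _ jlen.
  lra.
rewrite (big_cat_nat _ jlen)//= (big_cat_nat _ ilen)//=.
have [_ h1] := tele _ _ ji; have [h2 _] := tele _ _ (leq0n j);
  have [h3 _] := tele _ _ ilen.
lra.
Qed.

Lemma uniform_polygon_le (gamma : R -> 'rV[R]_3) (L : R) (n : nat) :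
  curve_length 0 1 gamma = L%:E ->
  \sum_(k < n.+1) enorm (gamma (k.+1%:R / n.+1%:R) - gamma (k%:R / n.+1%:R)) <= L.
Proof.
move=> hL; set s := [seq k%:R / n.+1%:R : R | k <- iota 1 n.+1].
have ss : size s = n.+1 by rewrite size_map size_iota.
have nthE k : (k <= n.+1)%N -> nth 1 (0 :: s) k = k%:R / n.+1%:R.
  case: k => [|k] kn; first by rewrite /= mul0r.
  by rewrite /= (nth_map 0%N) ?size_iota// nth_iota// add1n.
have np : (0 : R) < n.+1%:R^-1 by rewrite invr_gt0.
have ps : itv_partition 0 1 s.
  split.
    apply/(pathP 1) => k; rewrite ss => kn.
    have -> : nth 1 s k = nth 1 (0 :: s) k.+1 by [].
    by rewrite !nthE// 1?ltnW// ltr_pM2r// ltr_nat.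
  by rewrite (last_nth 1) ss nthE// divff.
have : ((polygon_length 0 1 gamma s)%:E <= L%:E)%E.
  by rewrite -hL; apply: ereal_sup_ubound; exists s.
rewrite lee_fin; apply: le_trans.
rewrite /polygon_length ss big_mkord le_eqVlt; apply/orP; left; apply/eqP.
by apply: eq_bigr => k _; rewrite !nthE// ltnW.
Qed.
End discretization.

(** * Lower bounds at a point *)

Section pointwise.
Context {R : realType}.
Implicit Types (C : set 'rV[R]_3) (x y c : 'rV[R]_3).

Lemma has_inf_dist C x : C `<=` sphere R -> C !=set0 -> sphere R x ->
  has_inf [set acos (dot x y) | y in C].
Proof.
move=> CS [y Cy] Sx; split; first by exists (acos (dot x y)), y.
by exists 0 => _ [z Cz <-]; apply/acos_ge0/dot_itv => //; exact: CS.
Qed.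

Lemma sdist_le C x y : C `<=` sphere R -> sphere R x -> C y ->
  sdist x C <= acos (dot x y).
Proof.
move=> CS Sx Cy; apply: ge_inf; last by exists y.
by apply: (has_inf_dist CS _ Sx).2; exists y.
Qed.

Lemma sdist_adherent C x e : C `<=` sphere R -> C !=set0 -> sphere R x -> 0 < e ->
  exists2 y, C y & acos (dot x y) < sdist x C + e.
Proof.
move=> CS C0 Sx e0; have [_ [y Cy <-] h] := inf_adherent e0 (has_inf_dist CS C0 Sx).
by exists y.
Qed.

Lemma sdist_itv C x : C `<=` sphere R -> C !=set0 -> sphere R x -> 0 <= sdist x C <= pi.
Proof.
move=> CS C0 Sx; apply/andP; split.
  apply: lb_le_inf => [|_ [y Cy <-]]; last by apply/acos_ge0/dot_itv => //; exact: CS.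
  exact: (has_inf_dist CS C0 Sx).1.
have [y Cy] := C0; apply: le_trans (sdist_le CS Sx Cy) _.
by apply/acos_lepi/dot_itv => //; exact: CS.
Qed.

(** [tau] is the smaller of [theta] and the circumradius of [C]: no
    cap of radius less than [tau] contains [C], but, unless [tau = theta],
    caps of radius slightly larger than [tau] do. *)
Lemma exists_critical_radius C theta : C `<=` sphere R -> C !=set0 -> 0 <= theta ->
  exists tau, [/\ 0 <= tau <= theta,
    forall x e, sphere R x -> 0 < e -> exists2 y, C y & tau - e < acos (dot x y) &
    forall e, 0 < e -> tau = theta \/
      exists2 c, sphere R c & forall y, C y -> acos (dot c y) <= tau + e].
Proof.
move=> CS C0 th0.
pose T := [set t | 0 <= t <= theta /\ forall x, sphere R x ->
  exists2 y, C y & t <= acos (dot x y)].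
have T0 : T 0.
  split; first by rewrite lexx.
  by move=> x Sx; have [y Cy] := C0; exists y => //; apply/acos_ge0/dot_itv => //;
    exact: CS.
have ubT : has_ubound T by exists theta => t [/andP[]].
have supT : has_sup T by split; first by exists 0.
have tau0 : 0 <= sup T by exact: ub_le_sup.
have tauth : sup T <= theta by apply: ge_sup => [|t [/andP[]]//]; exists 0.
exists (sup T); split.
- by rewrite tau0.
- move=> x e Sx e0; have [t [_ ht] te] := sup_adherent e0 supT.
  by have [y Cy hy] := ht x Sx; exists y => //; exact: lt_le_trans te hy.
move=> e e0; move: tauth; rewrite le_eqVlt => /predU1P[->|tauth]; [by left|right].
(* A value above [sup T] in [[0, theta]] fails for some point, the centre of a cap. *)
pose t := Num.min (sup T + e) theta.
have tT : ~ T t.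
  move=> /(ub_le_sup ubT); rewrite ge_min => /orP[]; lra.
have [x [Sx hx]] : exists x, sphere R x /\ forall y, C y -> acos (dot x y) < t.
  apply: contrapT => h; apply: tT; split.
    by rewrite le_min ge_min lexx orbT andbT; apply/andP; split; lra.
  move=> x Sx; apply: contrapT => hx; apply: h; exists x; split => // y Cy.
  by rewrite ltNge; apply/negP => hy; apply: hx; exists y.
by exists x => // y /hx/ltW/le_trans; apply; rewrite ge_min lexx.
Qed.

Lemma grid_near (s : R) (n : nat) : 0 <= s <= 1 ->
  exists k : nat, [/\ (k <= n.+1)%N, 0 <= (k%:R / n.+1%:R : R) <= 1 &
    `|s - k%:R / n.+1%:R| <= n.+1%:R^-1].
Proof.
move=> /andP[s0 s1]; have n0 : (0 : R) < n.+1%:R by [].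
have sn0 : 0 <= s * n.+1%:R by rewrite mulr_ge0.
have /andP[h1 h2] := truncn_itv sn0; set k := Num.truncn _ in h1 h2.
have kn : (k <= n.+1)%N.
  by rewrite -(ler_nat R) (le_trans h1)// ler_piMl.
exists k; split => //.
  by rewrite divr_ge0//= ler_pdivrMr// mul1r ler_nat.
have e : s - k%:R / n.+1%:R = (s * n.+1%:R - k%:R) / n.+1%:R.
  by rewrite mulrBl mulfK// gt_eqF.
rewrite e ger0_norm; last by rewrite divr_ge0// subr_ge0.
rewrite -[X in _ <= X]mul1r ler_pM2r ?invr_gt0// lerBlDr.
by move: h2; rewrite -natr1; lra.
Qed.

(** The capped distance from [x] to the sample points falls to about [sdist x C]
    and rises to about [tau], which gives [tau - sum / 2 <= sdist x C] up to an
    error. When [tau < theta], the triangle inequality with the centre [c] gives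
    also [angle (dot x c) - tau <= sdist x C]. The difference of the two ramps
    is [theta - tau] up to distance [2 tau] from [c] and then falls to [0] at
    distance [theta + tau]; it covers what is missing in either case. When
    [tau = theta] the ramps are equal. *)
Lemma pointwise_bound C (gamma : R -> 'rV[R]_3) (tau theta e : R) (n : nat) x c :
  C `<=` sphere R -> gamma @` `[0, 1] = C -> gamma 0 = gamma 1 ->
  (forall s t, 0 <= s <= 1 -> 0 <= t <= 1 -> `|s - t| <= n.+1%:R^-1 ->
     acos (dot (gamma s) (gamma t)) <= e) ->
  0 < e -> 0 <= tau <= theta ->
  (exists2 y, C y & tau - e < acos (dot x y)) ->
  (tau = theta \/ forall y, C y -> acos (dot c y) <= tau + e) ->
  sphere R x -> sphere R c ->
  theta + Num.max (2 * tau - angle (dot x c)) 0 <=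
  sdist x C + 2^-1 * (\sum_(k < n.+1)
     `|capped tau (dot x (gamma (k.+1%:R / n.+1%:R))) -
       capped tau (dot x (gamma (k%:R / n.+1%:R)))|)
  + Num.max (theta + tau - angle (dot x c)) 0 + 4 * e.
Proof.
move=> CS gC g01 gu e0 /andP[tau0 tauth] [yf Cyf hyf] hc Sx Sc.
have Cg s : 0 <= s <= 1 -> C (gamma s) by move=> s01; rewrite -gC; exists s => //=;
  rewrite in_itv.
have C0 : C !=set0 by exists yf.
pose a (k : nat) := capped tau (dot x (gamma (k%:R / n.+1%:R))).
have an : a 0 = a n.+1 by rewrite /a mul0r divff// g01.
set S := \sum_(k < _) _.
have SE : S = \sum_(k < n.+1) `|a k.+1 - a k| by [].
have S0 : 0 <= S by apply: sumr_ge0.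
have aE k : 0 <= (k%:R / n.+1%:R : R) <= 1 ->
    a k = Num.min (acos (dot x (gamma (k%:R / n.+1%:R)))) tau.
  by move=> k01; rewrite /a /capped angleE// dot_itv//; apply/CS/Cg.
have [yn Cyn hyn] := sdist_adherent CS C0 Sx e0.
have near_sample y : C y -> exists k, [/\ (k <= n.+1)%N, a k =
  Num.min (acos (dot x (gamma (k%:R / n.+1%:R)))) tau,
     acos (dot x (gamma (k%:R / n.+1%:R))) <= acos (dot x y) + e &
     acos (dot x y) <= acos (dot x (gamma (k%:R / n.+1%:R))) + e].
  rewrite -gC => -[s /=]; rewrite in_itv/= => s01 <-.
  have [k [kn k01 sk]] := grid_near n s01.
  have h := gu _ _ s01 k01 sk.
  have Ss := CS _ (Cg _ s01); have Sk := CS _ (Cg _ k01).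
  exists k; split => //; first exact: aE.
    by apply: le_trans (acos_triangle Sx Ss Sk) _; rewrite lerD2l.
  by apply: le_trans (acos_triangle Sx Sk Ss) _; rewrite lerD2l dotC.
have [i [iln ai hi _]] := near_sample _ Cyn.
have [j [jln aj _ hj]] := near_sample _ Cyf.
have := cyclic_variation iln jln an; rewrite -SE => hS.
(* Sampling costs [2 e] at the nearest and [2 e] at the farthest point. *)
have E1 : tau - 2^-1 * S - 4 * e <= sdist x C.
  have : tau - 2 * e <= a j by rewrite aj le_min; apply/andP; split; lra.
  have : a i <= sdist x C + 2 * e by rewrite ai ge_min; apply/orP; left; lra.
  by move=> h1 h2; lra.
have dI := dot_itv Sx Sc.
rewrite angleE//; set d := acos (dot x c).
have [tt|hc'] := hc.
  rewrite tt in E1 *; have -> : 2 * theta - d = theta + theta - d by ring.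
  by lra.
have E2 : d - tau - 2 * e <= sdist x C.
  have := acos_triangle Sx (CS _ Cyn) Sc; rewrite -/d [dot yn c]dotC.
  by have := hc' _ Cyn; lra.
rewrite /Num.max; case: ifP => h1; case: ifP => h2; lra.
Qed.

End pointwise.

(** * Integration of the pointwise bound *)

Section final.
Context {R : realType}.

(** Differentiated in [theta] this reads [1 - cos (theta + tau) <= 2 sin theta],
    and [1 - cos (theta + tau) <= 1 - cos (2 theta) = 2 sin^2 theta]. *)
Lemma cap_deficit_le (tau theta : R) : 0 <= tau <= theta -> theta <= pi / 2 ->
  theta - tau - sin (theta + tau) + sin (2 * tau) <= 2 * (cos tau - cos theta).
Proof.
move=> /andP[tau0 tt] thpi.
pose F x := - (2 * cos x) - x + sin (x + tau).
pose f x := 2 * sin x - 1 + cos (x + tau).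
have dF (x : R) : is_derive x (1 : R) F (f x).
  by apply: is_derive_eq; rewrite /f /= /GRing.scale/=; ring.
have [|c] := @MVT_segment R F f tau theta tt.
  apply: continuous_subspaceT => x; apply: differentiable_continuous.
  by apply/derivable1_diffP; apply: ex_derive.
rewrite in_itv/= => /andP[tc ct] E.
have c0pi : 0 <= c <= pi by apply/andP; split; have := @pi_ge0 R; lra.
have fc : 0 <= f c.
  have : cos (c + c) <= cos (c + tau).
    move: tc; rewrite le_eqVlt => /predU1P[->//|tc].
    apply: ltW; rewrite ltr_cos ?in_itv/= ?ltrD2l//; apply/andP; split; lra.
  rewrite cosD -!expr2 cos2sin2 /f.
  have := sin_ge0_pi c0pi; have := sin_le1 c; nra.
have : 0 <= F theta - F tau by rewrite E mulr_ge0// subr_ge0.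
have -> : 2 * tau = tau + tau by ring.
by rewrite /F; lra.
Qed.

Lemma tan_half (theta : R) : 0 < theta <= pi / 2 ->
  tan (theta / 2) = (1 - cos theta) / sin theta.
Proof.
move=> /andP[t0 tpi]; have pi0 := @pi_gt0 R.
have c0 : 0 < cos (theta / 2) by apply: cos_gt0_pihalf; apply/andP; split; lra.
have s0 : 0 < sin (theta / 2) by apply: sin_gt0_pi; apply/andP; split; lra.
rewrite {2 3}(splitr theta) cosD sinD -!expr2 cos2sin2 /tan.
by field; rewrite !gt_eqF// addr_gt0// mulr_gt0.
Qed.

Lemma measurable3_zonal (m : R -> R) (p : R * R * R) : measurable_fun setT m ->
  measurable3 (fun x y z => m (dot3 (x, y, z) p)).
Proof.
move=> mm; apply: (@measurable3_two_point R (fun u _ => m u) _ p p).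
exact: (measurableT_comp mm).
Qed.

(** The distance to the curve is bounded below by the measurable function [h],
    to which the additivity of the integral applies. All terms are moved to the
    side where they are nonnegative. *)
Lemma integrated_bound (C : set 'rV[R]_3) (gamma : R ->
  'rV[R]_3) (tau theta e : R) (n : nat)
    (c : 'rV[R]_3) (Lam : R) :
  C `<=` sphere R -> gamma @` `[0, 1] = C -> gamma 0 = gamma 1 ->
  (forall s t, 0 <= s <= 1 -> 0 <= t <= 1 -> `|s - t| <= n.+1%:R^-1 ->
     acos (dot (gamma s) (gamma t)) <= e) ->
  0 < e -> 0 <= tau <= theta -> theta <= pi / 2 ->
  (forall x, sphere R x -> exists2 y, C y & tau - e < acos (dot x y)) ->
  (tau = theta \/ forall y, C y -> acos (dot c y) <= tau + e) -> sphere R c ->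
  \sum_(k < n.+1) acos (dot (gamma (k.+1%:R / n.+1%:R)) (gamma (k%:R / n.+1%:R))) <=
    Lam ->
  4 * pi * theta + 2 * pi * (2 * tau - sin (2 * tau)) <=
  sphere_integral (fun x => sdist x C) + 2 * (1 - cos tau) * Lam +
  2 * pi * (theta + tau - sin (theta + tau)) + 4 * pi * (4 * e).
Proof.
move=> CS gC g01 gu e0 tt thpi hyf hc Sc hLam; have pi0 := @pi_gt0 R.
have /andP[tau0 tauth] := tt.
have Cg s : 0 <= s <= 1 -> C (gamma s) by move=> s01; rewrite -gC; exists s => //=;
  rewrite in_itv.
pose P (k : nat) := gamma (k%:R / n.+1%:R).
have SP k : (k <= n.+1)%N -> sphere R (P k).
  move=> kn; apply/CS/Cg; rewrite divr_ge0//= ler_pdivrMr// mul1r ler_nat//.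
have CN0 : C !=set0 by exists (gamma 0); apply: Cg; rewrite lexx ler01.
have cc : dot3 (coords c) (coords c) = 1 by rewrite -dotE sphereP.
pose Psi u v := `|capped tau u - capped tau v|.
have mPsi : measurable_fun setT (fun w : R * R => Psi w.1 w.2).
  apply: measurableT_comp => //; apply: measurable_funB.
    by apply: (measurableT_comp (measurable_capped tau)).
  by apply: (measurableT_comp (measurable_capped tau)).
pose F k (x y z : R) := Psi (dot3 (x, y, z) (coords (P k.+1))) (dot3 (x, y, z)
  (coords (P k))).
have mF k : measurable3 (F k) by exact: measurable3_two_point.
have F0 k x y z : 0 <= F k x y z by exact: normr_ge0.
pose S (x y z : R) := \sum_(k < n.+1) F k x y z.
have [SI mS] := sphere_lint_sum n.+1 mF F0.
have S0 x y z : 0 <= S x y z by apply: sumr_ge0.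
pose ramp b (x y z : R) := Num.max (b - angle (dot3 (x, y, z) (coords c))) 0.
have mramp b : measurable3 (ramp b).
  apply: (@measurable3_zonal (fun u => Num.max (b - angle u) 0)).
  by apply: measurable_maxr => //; apply: measurable_funB => //; exact: measurable_angle.
have ramp0 b x y z : 0 <= ramp b x y z by rewrite /ramp le_max lexx orbT.
have rampI b : 0 <= b <= pi -> sphere_lint (ramp b) = (2 * pi * (b - sin b))%:E.
  by move=> hb; exact: ramp_integral.
have mcst (b : R) : measurable3 (fun _ _ _ : R => b) by exact: measurable_cst.
have mS2 : measurable3 (fun x y z => 2^-1 * S x y z) by exact: measurable_funM.
pose h (x y z : R) := Num.max 0
  (theta + ramp (2 * tau) x y z - 2^-1 * S x y z - ramp (theta + tau) x y z - 4 * e).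
have mh : measurable3 h.
  apply: measurable_maxr => //; apply: measurable_funB => //; apply: measurable_funB;
    last exact: mramp.
  by apply: measurable_funB => //; apply: measurable_funD => //; exact: mramp.
have h0 x y z : 0 <= h x y z by rewrite /h le_max lexx.
have hJ : (sphere_lint h <= (sphere_integral (fun x => sdist x C))%:E)%E.
  apply: (@sphere_lint_le_sphere_integral R h _ pi) => // x y z xyz.
  have Sx := sphere_row3 xyz.
  have /andP[D0 Dpi] := sdist_itv CS CN0 Sx; rewrite Dpi andbT /h ge_max D0/=.
  have := pointwise_bound CS gC g01 gu e0 tt (hyf _ Sx) hc Sx Sc.
  rewrite /ramp /S /F /Psi dotE coords_row3.
  under eq_bigr do rewrite !dotE coords_row3.
  by rewrite -/(P _); lra.
have SI' : (sphere_lint S <= (4 * (1 - cos tau) * Lam)%:E)%E.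
  rewrite SI; apply: (@le_trans _ _
    (\sum_(k < n.+1) (4 * (1 - cos tau) * acos (dot (P k.+1) (P k)))%:E)%E).
    apply: lee_sum => k _; rewrite dotE.
    apply: two_point_capped_le; first by apply/andP; split; lra.
      by rewrite -dotE sphereP//; exact: SP.
    by rewrite -dotE sphereP//; apply: SP; exact: ltnW.
  rewrite sumEFin lee_fin -mulr_sumr; apply: ler_wpM2l; last exact: hLam.
  by rewrite mulr_ge0// subr_ge0 cos_le1.
have le1 : (sphere_lint (fun x y z => theta + ramp (2 * tau) x y z)%R <=
    sphere_lint (fun x y z => (((h x y z + 2^-1 * S x y z) + ramp (theta + tau) x y z) +
      4 * e)%R))%E.
  apply: sphere_lint_le => [x y z|x y z _]; first by rewrite addr_ge0//; lra.
  have : theta + ramp (2 * tau) x y z - 2^-1 * S x y z -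
      ramp (theta + tau) x y z - 4 * e <= h x y z.
    by rewrite /h le_max lexx orbT.
  by lra.
have S20 x y z : 0 <= 2^-1 * S x y z by rewrite mulr_ge0.
move: le1; rewrite (@sphere_lintD R (fun _ _ _ => theta))//; last by move=> *; lra.
rewrite sphere_lintD//; last 3 first.
- by do 2 apply: measurable3D => //.
- by move=> x y z; rewrite !addr_ge0.
- by move=> *; lra.
rewrite sphere_lintD//; last 2 first.
- exact: measurable3D.
- by move=> x y z; rewrite !addr_ge0.
rewrite sphere_lintD// sphere_lintZ// !sphere_lint_cst; [|lra..].
rewrite !rampI; [|by apply/andP; split; lra..].
have hSfin : (0 <= sphere_lint S)%E.
  rewrite sphere_lintE//; apply: integral_ge0 => z hz.
  by rewrite lee_fin sphere_fun_ge0.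
have hhfin : (0 <= sphere_lint h)%E.
  rewrite sphere_lintE//; apply: integral_ge0 => z hz.
  by rewrite lee_fin sphere_fun_ge0.
move: hJ SI' hSfin hhfin; case: (sphere_lint h) => [r1| |]//;
  case: (sphere_lint S) => [r2| |]//.
rewrite -!EFinM -!EFinD !lee_fin; lra.
Qed.
End final.

(** * The theorem *)

(** The points of a fine partition have consecutive angles of sum at most
    [L / cos e]. *)
Lemma bound_at_mesh (R : realType) (C : set 'rV[R]_3) (gamma : R -> 'rV[R]_3)
    (L tau theta e : R) :
  C `<=` sphere R -> simple_closed_param C gamma -> curve_length 0 1 gamma = L%:E ->
  0 <= tau <= theta -> theta <= pi / 2 -> 0 < e < 1 ->
  (forall x e, sphere R x -> 0 < e -> exists2 y, C y & tau - e < acos (dot x y)) ->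
  (tau = theta \/
      exists2 c, sphere R c & forall y, C y -> acos (dot c y) <= tau + e) ->
  4 * pi * theta + 2 * pi * (2 * tau - sin (2 * tau)) <=
  sphere_integral (fun x => sdist x C) + 2 * (1 - cos tau) * (L / cos e) +
  2 * pi * (theta + tau - sin (theta + tau)) + 4 * pi * (4 * e).
Proof.
move=> CS [cg gC g01 _] hL tt thpi /andP[e0 e1] H1 H2.
have pi2 := @pi_ge2 R.
have epi : 0 < e <= pi by apply/andP; split; lra.
have Cg s : 0 <= s <= 1 -> C (gamma s) by move=> s01; rewrite -gC; exists s => //=;
  rewrite in_itv.
have Sg s : 0 <= s <= 1 -> sphere R (gamma s) by move=> /Cg/CS.
have [n gu] := curve_uniformly_close cg Sg epi.
have [c Sc hc] : exists2 c, sphere R c & tau = theta \/ forall y, C y ->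
  acos (dot c y) <= tau + e.
  case: H2 => [tth|[c Sc hc]]; last by exists c => //; right.
  by exists (gamma 0); [apply: Sg; rewrite lexx ler01|left].
apply: (@integrated_bound R C gamma tau theta e n c) => //.
  by move=> x Sx; exact: H1.
have ce : 0 < cos e by apply: cos_gt0_pihalf; have := @pihalf_ge1 R; have := @pi_gt0 R;
  move=> *; apply/andP; split; lra.
rewrite ler_pdivlMr// mulr_suml; apply: le_trans (uniform_polygon_le n hL).
have k01 k : (k <= n.+1)%N -> 0 <= (k%:R / n.+1%:R : R) <= 1.
  by move=> kn; rewrite divr_ge0//= ler_pdivrMr// mul1r ler_nat.
apply: ler_sum => k _; rewrite dotC; apply: angle_le_chord.
- by apply: Sg; apply: k01; exact: ltnW.
- by apply: Sg; exact: k01.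
- by apply/andP; split; have := @pihalf_ge1 R; lra.
apply: gu; [by apply: k01; exact: ltnW|exact: k01|].
rewrite distrC -mulrBl -natr1 addrAC subrr add0r mul1r ger0_norm ?invr_ge0//.
Qed.

Theorem corollary7 (R : realType) (C : set 'rV[R]_3) (L theta : R)
  (hC : C `<=` sphere R)
  (hL : simple_closed_curve_of_length C L)
  (hL2pi : 2 * pi <= L)
  (htheta : 0 < theta <= pi / 2)
  (hsin : sin theta = 2 * pi / L) :
  theta - tan (theta / 2) <= mean_dist C.
Proof.
have pi0 := @pi_gt0 R.
have /andP[th0 thpi] := htheta.
have [gamma hg hlen] := hL.
have C0 : C !=set0.
  by case: hg => _ <- _ _; exists (gamma 0); exists 0 => //=; rewrite in_itv/= lexx ler01.
have [tau [tt H1 H2]] := exists_critical_radius hC C0 (ltW th0).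
set J := sphere_integral (fun x => sdist x C).
have B e : 0 < e < 1 -> 4 * pi * theta + 2 * pi * (2 * tau - sin (2 * tau)) <=
  J + 2 * (1 - cos tau) * (L / cos e) +
  2 * pi * (theta + tau - sin (theta + tau)) + 4 * pi * (4 * e).
  move=> e0; apply: (bound_at_mesh hC hg hlen) => //.
  by apply: H2; case/andP: e0.
pose W := 4 * pi * theta + 2 * pi * (2 * tau - sin (2 * tau)) - J -
  2 * pi * (theta + tau - sin (theta + tau)).
pose Z := 2 * (1 - cos tau) * L.
have L0 : 0 < L by apply: lt_le_trans hL2pi; rewrite mulr_gt0.
have Z0 : 0 <= Z by rewrite !mulr_ge0 ?(ltW L0)// subr_ge0 cos_le1.
have WZ : W <= Z.
  rewrite leNgt; apply/negP => ZW.
  (* With this mesh [(W - 16 pi e) (1 - e) >= W - e (W + 16 pi) > Z]. *)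
  pose e := (W - Z) / (2 * (W + 16 * pi)).
  have D0 : 0 < 2 * (W + 16 * pi) by lra.
  have eD : e * (2 * (W + 16 * pi)) = W - Z by rewrite /e divfK ?gt_eqF.
  have e0 : 0 < e by rewrite /e divr_gt0// subr_gt0.
  have e1 : e < 1 by rewrite /e ltr_pdivrMr// mul1r; lra.
  have := B e; rewrite e0 e1 => /(_ isT) Be.
  have ce : 0 < cos e.
    by apply: cos_gt0_pihalf; have := @pihalf_ge1 R; move=> *; apply/andP; split; lra.
  have {}Be : W <= Z / cos e + 16 * pi * e by rewrite /W /Z -mulrA; lra.
  have {}Be : (W - 16 * pi * e) * cos e <= Z.
    by rewrite -ler_pdivlMr// lerBlDr.
  have ce1 := cos_ge (ltW e0).
  have We : 0 <= W - 16 * pi * e by nra.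
  have : (W - 16 * pi * e) * (1 - e) <= Z by apply: le_trans Be; exact: ler_wpM2l.
  by nra.
have trig := cap_deficit_le tt thpi.
have cc : 0 <= cos tau - cos theta.
  have /andP[tau0 tauth] := tt; rewrite subr_ge0.
  move: tauth; rewrite le_eqVlt => /predU1P[->//|tth].
  by apply: ltW; rewrite ltr_cos ?in_itv/=//; apply/andP; split; lra.
have key : 4 * pi * theta <= J + 2 * L * (1 - cos theta).
  have : 2 * pi * (theta - tau - sin (theta + tau) + sin (2 * tau)) <=
    2 * pi * (2 * (cos tau - cos theta)).
    by apply: ler_wpM2l => //; lra.
  have : 2 * pi * (2 * (cos tau - cos theta)) <= L * (2 * (cos tau - cos theta)).
    by apply: ler_wpM2r => //; lra.
  by move: WZ; rewrite /W /Z; lra.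
rewrite tan_half// /mean_dist -/J.
have LE : L = 2 * pi / sin theta by rewrite hsin invf_div mulrCA divff ?mulr1 ?gt_eqF//
  mulr_gt0.
rewrite ler_pdivlMl ?mulr_gt0//.
have s0 : 0 < sin theta by apply: sin_gt0_pi; apply/andP; split; lra.
have -> : 4 * pi * (theta - (1 - cos theta) / sin theta) =
  4 * pi * theta - 2 * L * (1 - cos theta).
  by rewrite LE; field; rewrite gt_eqF.
lra.
Qed.
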